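(* Let $E$ be a finite set of $n$ points in $\mathbb{R}^3$ (with $n$ large) and let $k\ge 5$. Writing $\Lambda_m(E)$ for the set of tuples $(x_1,\dots,x_{m+2})\in E^{m+2}$ with $\angle(x_j,x_{j+1},x_{j+2})=\pi/2$ for all $1\le j\le m$, we have $$|\Lambda_k(E)|\lesssim n\,|\Lambda_{k-2}(E)|+n^{7/3}|\Lambda_{k-4}(E)|.$$
   Context: $\angle(x,y,z)\in[0,\pi]$ denotes the angle at $y$ between $x-y$ and $z-y$ (for $x\ne y\ne z$). $X\lesssim Y$ means $X\le CY$ for all $n>N$ with constants $C,N$ independent of $n$ (possibly depending on $k$). *)

(* Defs.v *)
From mathcomp Require Import all_boot all_order all_algebra finmap.
From mathcomp Require Import reals trigo.

Set Implicit Arguments.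
Unset Strict Implicit.
Unset Printing Implicit Defensive.

Import Order.TTheory GRing.Theory Num.Theory.
Local Open Scope ring_scope.

(* The norm that MathComp-Analysis puts on 'rV[R]_d is the sup norm, so the
   Euclidean structure is defined here. *)
Definition dotv (R : realType) (d : nat) (u v : 'rV[R]_d) : R :=
  \sum_(i < d) u 0 i * v 0 i.

Definition enorm (R : realType) (d : nat) (u : 'rV[R]_d) : R :=
  Num.sqrt (dotv u u).

(* Meaningful only for x != y and y != z: otherwise the quotient is 0 and the
   value is the junk value acos 0 = pi / 2. *)
Definition angle (R : realType) (d : nat) (x y z : 'rV[R]_d) : R :=
  acos (dotv (x - y) (z - y) / (enorm (x - y) * enorm (z - y))).

Definition right_angle (R : realType) (d : nat) (x y z : 'rV[R]_d) : bool :=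
  [&& x != y, y != z & angle x y z == pi / 2].

(* Tuples are indexed from 0, so j : 'I_m plays the role of j + 1 in
   1 <= j + 1 <= m; inord never truncates here since j + 2 < m + 2. *)
Definition Lambda (R : realType) (d : nat) (E : {fset 'rV[R]_d}) (m : nat) :
    {set m.+2.-tuple E} :=
  [set t : m.+2.-tuple E | [forall j : 'I_m,
     right_angle (val (tnth t (inord j)))
                 (val (tnth t (inord j.+1)))
                 (val (tnth t (inord j.+2)))]].

(* Main.v *)
Require Import Defs.
From mathcomp Require Import all_boot all_order all_algebra finmap.
From mathcomp Require Import boolp trigo.
From mathcomp Require Import zify ring lra.
From mathcomp Require Import reals exp.

Set Implicit Arguments.
Unset Strict Implicit.
Unset Printing Implicit Defensive.

Import Order.TTheory GRing.Theory Num.Theory.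
Local Open Scope ring_scope.

(** Write a chain as (x1, ..., x_(k+2)) and look at x4.  It lies on the plane
    through x3 normal to x2 - x3, on the plane through x5 normal to x6 - x5, and
    on the sphere with diameter x3 x5.  If the two planes are not parallel, x4 is
    one of at most two points once the right triple (x1, x2, x3) and the tail
    (x5, ..., x_(k+2)) are known.  If they are parallel, then x2 is the foot of
    the perpendicular from x1 to the line through x3 parallel to x5 x6, so that
    x1 and (x3, ..., x_(k+2)) determine the chain.  Hence
    |Lambda_k| <= n |Lambda_(k-2)| + 2 T |Lambda_(k-4)|, where T is the number of
    right triples.

    The bound T <= C n^(7/3) is due to Apfelbaum and Sharir.  A right triple with
    apex y is a pair of perpendicular lines through y, weighted by their numbers
    of other points.  Lines with more than m ~ n^(1/3) points contribute at most n
    for each incidence, because the end point off the line determines the apex.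
    The other lines are split by size into classes of ratio 8; for two classes the
    Szemeredi-Trotter inequality in the projective plane of directions at y is
    summed over y, using Szemeredi-Trotter once more to bound the number of
    incidences of the points with rich lines.  Szemeredi-Trotter itself is Szekely's
    crossing-number argument. *)

(** * Straight-line plane graphs *)

(** Most counts below go through this: [r] names data that determine [a], and choosing one related
    [b] for each [a] gives an injection. *)
Lemma card_le_rel (T U : finType) (A : {set T}) (B : {set U})
    (r : T -> U -> Prop) :
  (forall a, a \in A -> exists2 b, b \in B & r a b) ->
  (forall a a' b, a \in A -> a' \in A -> r a b -> r a' b -> a = a') ->
  (#|A| <= #|B|)%N.
Proof.
move=> rex rinj.
pose f a := [pick b in B | `[< r a b >]].
have fP a : a \in A -> exists2 b, f a = Some b & b \in B /\ r a b.
  move=> /rex[b bB rab]; rewrite /f; case: pickP => [c /andP[cB /asboolP rac]|].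
    by exists c.
  by move=> /(_ b); rewrite bB /=; case: asboolP.
have finj : {in A &, injective f}.
  move=> a a' aA a'A; have [b -> [_ rab]] := fP _ aA.
  have [b' -> [_ rab']] := fP _ a'A; case=> eb; subst b'.
  exact: rinj rab rab'.
rewrite -(card_in_imset finj).
have <- : #|[set Some b | b in B]| = #|B| by apply: card_imset; exact: Some_inj.
apply/subset_leq_card/subsetP => o /imsetP[a aA ->].
by have [b -> [bB _]] := fP _ aA; apply: imset_f.
Qed.

Section PlaneGraph.
Variables (R : realFieldType) (V E : finType).
Variables (x y : V -> R) (src tgt : E -> V) (sl ic : E -> R).

Let h e t := sl e * t + ic e.

(** Over the common interval [[t0, t1]] the segment of [e] passes from strictly below to strictly
    above that of [e']. The relation is oriented, so a geometric crossing is recorded in one order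
    only, and contact at an end is no crossing. *)
Definition crossing e e' := exists t0 t1 : R,
  [/\ t0 < t1, x (src e) <= t0 /\ x (src e') <= t0,
      t1 <= x (tgt e) /\ t1 <= x (tgt e'),
      sl e * t0 + ic e < sl e' * t0 + ic e' &
      sl e' * t1 + ic e' < sl e * t1 + ic e].

Variables (S : {set V}) (G : {set E}).
Hypothesis xinj : {in S &, injective x}.
Hypothesis srcS : forall e, e \in G -> src e \in S.
Hypothesis tgtS : forall e, e \in G -> tgt e \in S.
Hypothesis lt_src_tgt : forall e, e \in G -> x (src e) < x (tgt e).
Hypothesis ysrc : forall e, e \in G -> y (src e) = h e (x (src e)).
Hypothesis ytgt : forall e, e \in G -> y (tgt e) = h e (x (tgt e)).
Hypothesis slinj : forall e e', e \in G -> e' \in G ->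
  src e = src e' -> sl e = sl e' -> e = e'.

Let succ e e' := [/\ e' \in G, src e' = src e, sl e < sl e' &
  forall f, f \in G -> src f = src e -> sl e < sl f -> sl e' <= sl f].

Let wedge e e' v := [/\ x (src e) < x v, x v <= x (tgt e), x v <= x (tgt e'),
  h e (x v) <= y v & y v <= h e' (x v)].

(* The vertical segment through [u] is the right wall of the cell of the wedge
   between [e] and its successor [e'] at their common source; [b] records
   whether that cell lies above [u]. *)
Let charge e (ub : V * bool) := exists e', [/\ succ e e', wedge e e' ub.1,
  forall v, v \in S -> x v < x ub.1 -> ~ wedge e e' v &
  ub.2 = (y ub.1 < h e' (x ub.1))].

Lemma above_succ e e' t : e \in G -> succ e e' -> x (src e) < t -> h e t < h e' t.
Proof.
move=> eG [e'G se' lt _] lt_t; have := ysrc e'G; rewrite se' (ysrc eG) /h => eqy.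
have : 0 < (sl e' - sl e) * (t - x (src e)) by rewrite mulr_gt0 ?subr_gt0.
lra.
Qed.

(** Wedges with a common source are stacked by slope, so two of them share [u] only on a boundary:
    [u] is then on the upper edge of the lower wedge and strictly below the upper edge of the other,
    and the flags differ. *)
Lemma charge_inj_src e f ub :
  e \in G -> f \in G -> src e = src f -> sl e < sl f ->
  charge e ub -> charge f ub -> False.
Proof.
case: ub => u b eG fG sef lt_ef [e' [/= se we _ eb]] [f' [/= sf wf _ fb]].
have [e'G se' lte' e'min] := se; have le := e'min f fG (esym sef) lt_ef.
case: we => lt1 _ _ _ l2; case: wf => _ _ _ m1 m2.
have := above_succ fG sf; rewrite -sef => /(_ _ lt1) m3.
have l4 : h e' (x u) <= h f (x u).
  have := ysrc fG; have := ysrc e'G; rewrite se' -sef => -> eqy.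
  have : 0 <= (sl f - sl e') * (x u - x (src e)).
    by rewrite mulr_ge0 ?subr_ge0 ?(ltW lt1).
  move: eqy; rewrite /h; lra.
have lt_uf' := le_lt_trans (le_trans l2 l4) m3.
move: eb; rewrite fb lt_uf' => /esym lt_ue'.
by have := lt_le_trans lt_ue' (le_trans l4 m1); rewrite ltxx.
Qed.

Hypothesis nocross : forall e e', e \in G -> e' \in G -> ~ crossing e e'.

(** The source of [f] comes before [u], the first vertex in the wedge of [e], so it lies above [e']
    or below [e]. At [u] the wedges meet, and equal flags make the order strict there: [e'] crosses
    [f], or [f'] crosses [e]. *)
Lemma charge_inj_lt e f ub : e \in G -> f \in G -> x (src e) < x (src f) ->
  charge e ub -> charge f ub -> False.
Proof.
case: ub => u b eG fG lt_ef [e' [/= se we wmin eb]] [f' [/= sf wf _ fb]].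
have [e'G se' _ _] := se; have [f'G sf' _ _] := sf.
case: we => lt1 lt2 lt3 l1 l2; case: wf => mt1 mt2 mt3 m1 m2.
have e_e' := above_succ eG se lt1; have f_f' := above_succ fG sf mt1.
have yf := ysrc fG; have yf' := ysrc f'G; rewrite sf' in yf'.
have := wmin _ (srcS fG) mt1.
have [ab|nab] := ltP (h e' (x (src f))) (y (src f)) => nw.
- have := nocross e'G fG; apply; exists (x (src f)), (x u).
  split=> //; rewrite ?se'; first by split; rewrite ?lexx ?ltW.
    by rewrite -[_ + _]/(h e' _) -[_ * _ + ic f]/(h f _) -yf.
  rewrite -[_ + _]/(h f _) -[_ * _ + ic e']/(h e' _).
  have [lt_ue'|ge_ue'] := ltP (y u) (h e' (x u)).
    exact: le_lt_trans m1 lt_ue'.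
  move: fb; rewrite eb ltNge ge_ue' => /esym/negbT; rewrite -leNgt => ge_uf'.
  exact: lt_le_trans f_f' (le_trans ge_uf' l2).
have [ab|nab'] := ltP (y (src f)) (h e (x (src f))).
- have := nocross f'G eG; apply; exists (x (src f)), (x u).
  split=> //; rewrite ?sf'; first by split; rewrite ?lexx ?ltW.
    by rewrite -[_ + _]/(h f' _) -[_ * _ + ic e]/(h e _) -yf'.
  rewrite -[_ + _]/(h e _) -[_ * _ + ic f']/(h f' _).
  have [lt_uf'|ge_uf'] := ltP (y u) (h f' (x u)).
    exact: le_lt_trans l1 lt_uf'.
  move: eb; rewrite fb ltNge ge_uf' => /esym/negbT; rewrite -leNgt => ge_ue'.
  exact: lt_le_trans e_e' (le_trans ge_ue' m2).
by apply: nw; split=> //; apply: ltW; apply: lt_le_trans mt1 _.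
Qed.

Lemma charge_inj e f ub :
  e \in G -> f \in G -> charge e ub -> charge f ub -> e = f.
Proof.
move=> eG fG ce cf.
have [lt|lt|] := ltgtP (x (src e)) (x (src f)).
- by case: (charge_inj_lt eG fG lt ce cf).
- by case: (charge_inj_lt fG eG lt cf ce).
move=> /(xinj (srcS eG) (srcS fG)) sef.
have [lt|lt|] := ltgtP (sl e) (sl f); last exact: slinj.
- by case: (charge_inj_src eG fG sef lt ce cf).
- by case: (charge_inj_src fG eG (esym sef) lt cf ce).
Qed.

Let top e := [forall f in G, (src f == src e) ==> (sl f <= sl e)].

Lemma charge_ex e : e \in G -> ~~ top e ->
  exists2 ub, ub \in setX S [set: bool] & charge e ub.
Proof.
move=> eG; rewrite negb_forall => /existsP[f0].
rewrite !negb_imply -ltNge => /and3P[f0G /eqP sf0 ltf0].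
pose P f := [&& f \in G, src f == src e & sl e < sl f].
have P0 : P f0 by rewrite /P f0G sf0 eqxx.
case: (@arg_minP _ _ _ f0 P sl P0) => e' /and3P[e'G /eqP se' lte'] e'min.
have sce : succ e e'.
  by split=> // f fG sf ltf; apply: e'min; rewrite /P fG sf eqxx.
pose Q v := [&& v \in S, x (src e) < x v, x v <= x (tgt e), x v <= x (tgt e'),
  h e (x v) <= y v & y v <= h e' (x v)].
(* The nearer of the two targets lies in the wedge, so there is a leftmost vertex to charge. *)
have [v0 Q0] : exists v, Q v.
  have [le|lt] := leP (x (tgt e)) (x (tgt e')).
    exists (tgt e); rewrite /Q tgtS // lt_src_tgt // lexx le (ytgt eG) lexx /=.
    exact/ltW/above_succ/lt_src_tgt.
  have lt' : x (src e) < x (tgt e') by rewrite -se' lt_src_tgt.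
  exists (tgt e'); rewrite /Q tgtS // lt' (ltW lt) lexx (ytgt e'G) lexx /= andbT.
  exact/ltW/above_succ.
case: (@arg_minP _ _ _ v0 Q x Q0) => u /and3P[uS u1 /and4P[u2 u3 u4 u5]] umin.
exists (u, y u < h e' (x u)); first by rewrite inE /= uS inE.
exists e'; split=> //= v vS ltv [v1 v2 v3 v4 v5].
by have := umin v; rewrite /Q vS v1 v2 v3 v4 v5 => /(_ isT); rewrite leNgt ltv.
Qed.

(** This replaces Euler's formula. The steepest edge at each source is charged to that source, every
    other edge to a vertex with a flag, which gives [#|S| + 2 * #|S|]. *)
Lemma plane_graph_edges : (#|G| <= 3 * #|S|)%N.
Proof.
rewrite -(cardsID [set e | top e] G).
have -> : (3 * #|S| = #|S| + #|setX S [set: bool]|)%N.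
  by rewrite cardsX cardsT card_bool; lia.
apply: leq_add.
  apply: (@card_le_rel _ _ _ _ (fun e v => src e = v)) => [e|e f v].
    by rewrite !inE => /andP[eG _]; exists (src e); rewrite ?srcS.
  rewrite !inE => /andP[eG /forallP te] /andP[fG /forallP tf] sv fv.
  apply: slinj => //; first by rewrite sv fv.
  have := te f; have := tf e; rewrite eG fG sv fv eqxx /= => l1 l2.
  by apply/eqP; rewrite eq_le l1 l2.
apply: (@card_le_rel _ _ _ _ charge) => [e|e f v].
  by rewrite !inE => /andP[nt eG]; apply: charge_ex.
by rewrite !inE => /andP[_ eG] /andP[_ fG]; apply: charge_inj.
Qed.

End PlaneGraph.

(** * Sampling vertices at random *)

Section Sampling.
Variables (V T : finType) (q : nat).

(** A function into ['I_q.+1] is one outcome of the sampling, in which [v] survives when its value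
    is [ord0]. All of [D] survives with probability [1 / q.+1 ^ #|D|]; here denominators are
    cleared. *)
Lemma card_vanishing (D : {set V}) :
  (#|[set f : {ffun V -> 'I_q.+1} | [forall v in D, f v == ord0]]| * q.+1 ^ #|D| =
   q.+1 ^ #|V|)%N.
Proof.
pose F v : {pred 'I_q.+1} := [pred i | (v \in D) ==> (i == ord0)].
have -> : #|[set f : {ffun V -> 'I_q.+1} | [forall v in D, f v == ord0]]| = #|family F|.
  by apply: eq_card => f; rewrite inE; apply: eq_forallb.
rewrite card_family foldrE big_map -/(index_enum _) big_enum/=.
have -> : (q.+1 ^ #|D| = \prod_(v : V) (if v \in D then q.+1 else 1))%N.
  by rewrite -big_mkcond prod_nat_const.
have -> : (q.+1 ^ #|V| = \prod_(v : V) q.+1)%N by rewrite prod_nat_const.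
rewrite -big_split /=.
apply: eq_bigr => v _; rewrite /F; case: (v \in D) => /=.
  by rewrite (eq_card (B := pred1 ord0)) ?card1 ?mul1n.
by rewrite (eq_card (B := predT)) ?card_ord ?muln1.
Qed.

(** Linearity of expectation, as an exchange of sums: each [a] survives in a fraction [1 / q.+1 ^ d]
    of the outcomes. *)
Lemma sum_vanishing (A : {set T}) (D : T -> {set V}) d :
  (forall a, a \in A -> #|D a| = d) ->
  ((\sum_(f : {ffun V -> 'I_q.+1}) #|[set a in A | [forall v in D a, f v == ord0]]|) *
   q.+1 ^ d = #|A| * q.+1 ^ #|V|)%N.
Proof.
move=> cD.
under eq_bigr => f _ do rewrite -sum1_card big_mkcond /=.
rewrite exchange_big /= big_distrl /= -sum_nat_const [RHS]big_mkcond /=.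
apply: eq_bigr => a _; case: ifP => aA; last first.
  by rewrite big1 // => f _; rewrite inE aA.
rewrite -(card_vanishing (D a)) (cD a aA); congr (_ * _)%N.
rewrite -sum1_card [RHS]big_mkcond /=.
by apply: eq_bigr => f _; rewrite !inE aA.
Qed.

End Sampling.

(** * The crossing lemma *)

Section CrossingLemma.
Variables (R : realFieldType) (V E : finType).
Variables (x y : V -> R) (src tgt : E -> V) (sl ic : E -> R).

Definition crossings (G : {set E}) : {set E * E} :=
  [set p | [&& p.1 \in G, p.2 \in G & `[< crossing x src tgt sl ic p.1 p.2 >]]].

Definition plane_drawing (S : {set V}) (G : {set E}) :=
  {in S &, injective x} /\
  (forall e, e \in G -> [/\ src e \in S, tgt e \in S, x (src e) < x (tgt e),
     y (src e) = sl e * x (src e) + ic e & y (tgt e) = sl e * x (tgt e) + ic e]) /\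
  (forall e e', e \in G -> e' \in G -> src e = src e' -> sl e = sl e' -> e = e').

(** Deleting an edge that takes part in a crossing removes at least that crossing; repeated until
    none is left, this reduces to the plane case. *)
Lemma plane_drawing_crossings S G : plane_drawing S G ->
  (#|G| <= 3 * #|S| + #|crossings G|)%N.
Proof.
move=> [xinj]; have [n] := ubnP #|G|.
elim: n G => // n IHn G leGn [Gline Ginj].
have [C0|[[e f]]] := set_0Vmem (crossings G).
  rewrite C0 cards0 addn0.
  apply: (@plane_graph_edges _ _ _ x y src tgt sl ic) => // [e|e|e|e|e|e f eG fG /asboolP c];
    try by move=> /Gline[].
  by have := in_set0 (e, f); rewrite -C0 inE /= eG fG c.
move=> Cef; move: (Cef); rewrite inE /= => /and3P[eG fG _].
have : (#|G :\ e| <= 3 * #|S| + #|crossings (G :\ e)|)%N.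
  apply: IHn; first by rewrite (cardsD1 e) eG in leGn.
  split=> [a|a b]; first by rewrite inE => /andP[_ /Gline].
  by rewrite !inE => /andP[_ aG] /andP[_ bG]; apply: Ginj.
have : (#|crossings (G :\ e)| <= #|crossings G :\ (e, f)|)%N.
  apply/subset_leq_card/subsetP => -[a b]; rewrite !inE /=.
  move=> /and3P[/andP[ae aG] /andP[be bG] ->]; rewrite aG bG !andbT.
  by apply: contra ae => /eqP[->].
rewrite (cardsD1 e G) (cardsD1 (e, f) (crossings G)) eG Cef !add1n addnS ltnS.
by move=> leC leG; apply: leq_trans leG _; rewrite leq_add2l.
Qed.

(** Two lines through a common end keep their order on the side where both edges lie, so crossing
    edges share no end. A crossing thus survives the sampling with the fourth power of the rate. *)
Lemma crossing_ends S G e f : plane_drawing S G -> e \in G -> f \in G ->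
  crossing x src tgt sl ic e f -> #|[set src e; tgt e; src f; tgt f]| = 4.
Proof.
move=> [xinj [Gline _]] /Gline[_ _ lte se te] /Gline[_ _ ltf sf tf].
move=> [t0 [t1 [lt01 [e0 f0] [e1 f1] c0 c1]]].
have ef : src e != tgt f by apply/eqP => E1; rewrite E1 in e0; lra.
have fe : src f != tgt e by apply/eqP => E1; rewrite E1 in f0; lra.
have ee : src e != tgt e by apply/eqP => E1; rewrite E1 in lte; lra.
have ff : src f != tgt f by apply/eqP => E1; rewrite E1 in ltf; lra.
have ss : src e != src f.
  apply/eqP => E1; rewrite -E1 se in sf; rewrite -E1 in f0.
  suff : 0 <= (sl f - sl e) * (t1 - t0) by lra.
  have : 0 < (sl f - sl e) * (t0 - x (src e)) by lra.
  move=> pos; have d0 : 0 <= t0 - x (src e) by lra.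
  apply: mulr_ge0; last lra.
  by rewrite leNgt; apply/negP => neg; have := mulr_le0_ge0 (ltW neg) d0; lra.
have tt : tgt e != tgt f.
  apply/eqP => E1; rewrite -E1 te in tf; rewrite -E1 in f1.
  suff : 0 <= (sl f - sl e) * (t1 - t0) by lra.
  have : 0 < (sl f - sl e) * (x (tgt e) - t1) by lra.
  move=> pos; have d0 : 0 <= x (tgt e) - t1 by lra.
  apply: mulr_ge0; last lra.
  by rewrite leNgt; apply/negP => neg; have := mulr_le0_ge0 (ltW neg) d0; lra.
rewrite setUC cardsU1 setUC cardsU1 cards2 ee !inE.
rewrite !negb_or (eq_sym (tgt f)) (eq_sym (tgt f)) ff (eq_sym (tgt f)) tt ef.
by rewrite (eq_sym (src f)) ss fe.
Qed.

(* Apply the linear bound to the subgraph induced on a random vertex set in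
   which each vertex survives with probability [1 / q]. *)
Lemma crossing_lemma S G q : plane_drawing S G ->
  (q.+1 ^ 2 * #|G| <= 3 * q.+1 ^ 3 * #|S| + #|crossings G|)%N.
Proof.
move=> SG; have [xinj [Gline Ginj]] := SG.
pose Sf (f : {ffun V -> 'I_q.+1}) := [set v in S | [forall w in [set v], f w == ord0]].
pose Gf (f : {ffun V -> 'I_q.+1}) :=
  [set e in G | [forall w in [set src e; tgt e], f w == ord0]].
pose Cf (f : {ffun V -> 'I_q.+1}) := [set p in crossings G |
  [forall w in [set src p.1; tgt p.1; src p.2; tgt p.2], f w == ord0]].
have le_f f : (#|Gf f| <= 3 * #|Sf f| + #|Cf f|)%N.
  apply: (@leq_trans (3 * #|Sf f| + #|crossings (Gf f)|)).
    apply: plane_drawing_crossings; split; last split.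
    - by move=> v w; rewrite !inE => /andP[vS _] /andP[wS _]; apply: xinj.
    - move=> e; rewrite inE => /andP[/Gline[sS tS lte se te] /forall_inP f0].
      by split=> //; rewrite inE ?sS ?tS /=;
        apply/forall_inP => w /set1P->; apply: f0; rewrite ?set21 ?set22.
    - by move=> e e'; rewrite !inE => /andP[eG _] /andP[eG' _]; apply: Ginj.
  rewrite leq_add2l; apply/subset_leq_card/subsetP => -[a b].
  rewrite !inE /= => /and3P[/andP[aG /forall_inP fa] /andP[bG /forall_inP fb] ->].
  rewrite aG bG /=; apply/forall_inP => w; rewrite !inE -!orbA.
  by case/or4P => /eqP->; [apply: fa|apply: fa|apply: fb|apply: fb];
    rewrite !inE eqxx ?orbT.
have : (\sum_f #|Gf f| <= 3 * (\sum_f #|Sf f|) + \sum_f #|Cf f|)%N.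
  by rewrite big_distrr -big_split /=; apply: leq_sum => f _; apply: le_f.
have eS : ((\sum_f #|Sf f|) * q.+1 ^ 1 = #|S| * q.+1 ^ #|V|)%N.
  by apply: sum_vanishing => v _; rewrite cards1.
have eG : ((\sum_f #|Gf f|) * q.+1 ^ 2 = #|G| * q.+1 ^ #|V|)%N.
  apply: sum_vanishing => e /Gline[_ _ lte _ _]; rewrite cards2.
  by case: eqVneq lte => // ->; rewrite ltxx.
have eC : ((\sum_f #|Cf f|) * q.+1 ^ 4 = #|crossings G| * q.+1 ^ #|V|)%N.
  apply: sum_vanishing => -[a b]; rewrite inE /= => /and3P[aG bG /asboolP].
  exact: crossing_ends SG aG bG.
move: (\sum_f _)%N (\sum_f _)%N (\sum_f _)%N eS eG eC => c g s eS eG eC le.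
have Q0 : (0 < q.+1 ^ #|V|)%N by rewrite expn_gt0.
rewrite -(leq_pmul2r Q0) mulnDl -!mulnA -eS -eG -eC.
(* Multiplied by [q.+1 ^ 4], the sums for edges, vertices and crossings leave the factors
   [q.+1 ^ 2], [q.+1 ^ 3] and 1. *)
have le4 := leq_mul (leqnn (q.+1 ^ 4)%N) le.
by apply: leq_trans (leq_trans (eq_leq _) le4) (eq_leq _); ring.
Qed.

End CrossingLemma.

(** * Incidences of points and lines in the plane *)

Section SzemerediTrotter.
Variables (R : realFieldType) (P L : finType).
Variables (x y : P -> R) (s c : L -> R) (inc : P -> L -> bool).
Variables (A : {set P}) (B : {set L}).
Hypothesis xinj : {in A &, injective x}.
Hypothesis incE : forall v l, v \in A -> l \in B -> inc v l -> y v = s l * x v + c l.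
Hypothesis sinj : forall v l l', v \in A -> l \in B -> l' \in B ->
  inc v l -> inc v l' -> s l = s l' -> l = l'.

Let I : {set P * L} := [set e in setX A B | inc e.1 e.2].

Let isnext (e : P * L) w := [&& w \in A, inc w e.2, x e.1 < x w &
  [forall w' in A, inc w' e.2 ==> (x e.1 < x w') ==> (x w <= x w')]].
(** An edge is an incidence joined to the next point on its line. At the last point the default
    [e.1] is returned, and the strict inequality in [G] discards that incidence. *)
Let next e := odflt e.1 [pick w | isnext e w].
Let G := [set e in I | x e.1 < x (next e)].

Let nextP e w : w \in A -> inc w e.2 -> x e.1 < x w ->
  [/\ next e \in A, inc (next e) e.2, x e.1 < x (next e) & x (next e) <= x w].
Proof.
move=> wA wl ltw; pose Q w := [&& w \in A, inc w e.2 & x e.1 < x w].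
have Qw : Q w by rewrite /Q wA wl.
case: (@arg_minP _ _ _ w Q x Qw) => u /and3P[uA ul ltu] umin.
rewrite /next; case: pickP => [z /and4P[zA zl ltz /forall_inP zmin]|/(_ u)] /=.
  by split=> //; have /implyP/(_ wl)/implyP/(_ ltw) := zmin _ wA.
move=> /negP[]; apply/and4P; split=> //; apply/forall_inP => w' w'A.
by apply/implyP => w'l; apply/implyP => ltw'; apply: umin; rewrite /Q w'A w'l.
Qed.

Let mem_next e : e \in G -> [/\ next e \in A, inc (next e) e.2, x e.1 < x (next e) &
  forall w, w \in A -> inc w e.2 -> x e.1 < x w -> x (next e) <= x w].
Proof.
rewrite inE /next => /andP[_].
case: pickP => [z /and4P[zA zl ltz /forall_inP zmin] _|_] /=; last by rewrite ltxx.
by split=> // w wA wl ltw; have /implyP/(_ wl)/implyP/(_ ltw) := zmin _ wA.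
Qed.

(** Only the rightmost point of each line fails to start an edge. *)
Let card_I : (#|I| <= #|G| + #|B|)%N.
Proof.
rewrite -(cardsID G I) leq_add ?subset_leq_card ?subsetIr //.
apply: (@card_le_rel _ _ _ _ (fun e l => e.2 = l)) => [e|[v l] [w l'] l0].
  by rewrite !inE => /andP[_ /andP[/andP[_ lB] _]]; exists e.2.
rewrite !inE /= => /andP[nG /andP[/andP[vA lB] vl]].
move=> /andP[nG' /andP[/andP[wA _] wl]] el el'; subst l l'.
rewrite vA lB vl /= in nG; rewrite wA lB wl /= in nG'.
have [lt|lt|/(xinj vA wA)->//] := ltgtP (x v) (x w).
  by case/negP: nG; have [] := @nextP (v, l0) w wA wl lt.
by case/negP: nG'; have [] := @nextP (w, l0) v vA vl lt.
Qed.

Let src (e : P * L) := e.1.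
Let sl (e : P * L) := s e.2.
Let ic (e : P * L) := c e.2.

Let drawing : plane_drawing x y src next sl ic A G.
Proof.
split=> //; split=> [e eG|[v l] [w l']].
  have [nA nl ltn _] := mem_next eG; move: eG; rewrite !inE.
  by move=> /andP[/andP[/andP[eA eB] el] _]; split=> //; apply: incE.
rewrite !inE /src /sl /= => /andP[/andP[/andP[vA lB] vl] _].
move=> /andP[/andP[/andP[_ l'B] wl'] _] evw /(sinj vA lB l'B vl); rewrite evw.
by move=> ->.
Qed.

(** The abscissa [X] of the meeting point depends on the two lines alone, and it is strictly inside
    both edges. *)
Let crossing_root e f : crossing x src next sl ic e f ->
  sl e != sl f /\ let X := (ic f - ic e) / (sl e - sl f) in
  [/\ x e.1 < X, X < x (next e), x f.1 < X & X < x (next f)].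
Proof.
move=> [t0 [t1 [lt01 [e0 f0] [e1 f1] c0 c1]]].
have sef : sl f < sl e.
  rewrite ltNge; apply/negP => le.
  have : 0 <= (sl f - sl e) * (t1 - t0) by rewrite mulr_ge0 ?subr_ge0 // ltW.
  lra.
have d0 : 0 < sl e - sl f by rewrite subr_gt0.
split; first by rewrite gt_eqF.
have h0 : t0 < (ic f - ic e) / (sl e - sl f) by rewrite ltr_pdivlMr //; lra.
have h1 : (ic f - ic e) / (sl e - sl f) < t1 by rewrite ltr_pdivrMr //; lra.
move=> X; split; [exact: le_lt_trans h0|exact: lt_le_trans e1|
  exact: le_lt_trans h0|exact: lt_le_trans f1].
Qed.

Let same_edge e f X : e \in G -> f \in G -> e.2 = f.2 ->
  x e.1 < X -> X < x (next e) -> x f.1 < X -> X < x (next f) -> e = f.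
Proof.
case: e f => [v l] [w l'] eG fG /= el; subst l' => v1 v2 w1 w2.
have [_ _ _ vmin] := mem_next eG; have [_ _ _ wmin] := mem_next fG.
move: eG fG; rewrite !inE /= => /andP[/andP[/andP[vA _] vl] _].
move=> /andP[/andP[/andP[wA _] wl] _].
have [lt|lt|/(xinj vA wA)->//] := ltgtP (x v) (x w).
  by have := lt_trans v2 (le_lt_trans (vmin w wA wl lt) w1); rewrite ltxx.
by have := lt_trans w2 (le_lt_trans (wmin v vA vl lt) v1); rewrite ltxx.
Qed.

(** Two lines meet at most once, and the meeting point is interior to at most one edge of each, so a
    pair of lines determines the pair of edges. *)
Let card_crossings : (#|crossings x src next sl ic G| <= #|B| ^ 2)%N.
Proof.
rewrite -[X in (_ <= X)%N]mulnn -cardsX.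
apply: (@card_le_rel _ _ _ _ (fun p q => (p.1.2, p.2.2) = q)) => [[e f]|[e f] [e' f'] q].
  rewrite !inE /= => /and3P[/andP[/andP[/andP[_ eB] _] _] /andP[/andP[/andP[_ fB] _] _] _].
  by exists (e.2, f.2); rewrite // inE eB.
rewrite !inE -/(I) /= => /and3P[eG fG /asboolP/crossing_root[_ [e1 e2 f1 f2]]].
move=> /and3P[e'G f'G /asboolP/crossing_root[_ [e1' e2' f1' f2']]] <- [el fl].
rewrite /sl /ic el fl in e1' e2' f1' f2'.
congr (_, _); [apply: (same_edge _ _ _ e1 e2) => //|apply: (same_edge _ _ _ f1 f2) => //];
  by rewrite ?inE // (eG, fG, e'G, f'G).
Qed.

(* With [q.+1] of order [|B| ^ (2/3) / |A| ^ (1/3)] this is the usual bound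
   [|A| ^ (2/3) * |B| ^ (2/3) + |A| + |B|], up to a constant. *)
Theorem szemeredi_trotter q : (q.+1 ^ 2 * #|[set e in setX A B | inc e.1 e.2]| <=
  q.+1 ^ 2 * #|B| + 3 * q.+1 ^ 3 * #|A| + #|B| ^ 2)%N.
Proof.
apply: leq_trans (leq_mul (leqnn _) card_I) _.
rewrite mulnDr addnC -addnA leq_add2l.
by apply: leq_trans (crossing_lemma q drawing) _; rewrite leq_add2l card_crossings.
Qed.

End SzemerediTrotter.

(** * Vectors in space *)

Section Coordinates.
Variable R : realType.
Implicit Types (u v w d f g h k : 'rV[R]_3) (a b c t : R).

Definition cx u : R := u 0 (@Ordinal 3 0 isT).
Definition cy u : R := u 0 (@Ordinal 3 1 isT).
Definition cz u : R := u 0 (@Ordinal 3 2 isT).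
Definition vec a b c : 'rV[R]_3 := \row_(i < 3) [:: a; b; c]`_i.
Definition cross u v : 'rV[R]_3 :=
  vec (cy u * cz v - cz u * cy v) (cz u * cx v - cx u * cz v) (cx u * cy v - cy u * cx v).

Lemma coord_vec a b c :
  ((cx (vec a b c) = a) * (cy (vec a b c) = b) * (cz (vec a b c) = c))%type.
Proof. by do !split; rewrite /cx /cy /cz !mxE. Qed.

Lemma coordD u v :
  ((cx (u + v) = (cx u + cx v)%R) * (cy (u + v) = (cy u + cy v)%R) *
   (cz (u + v) = (cz u + cz v)%R))%type.
Proof. by do !split; rewrite /cx /cy /cz !mxE. Qed.

Lemma coordN u :
  ((cx (- u) = - cx u) * (cy (- u) = - cy u) * (cz (- u) = - cz u))%type.
Proof. by do !split; rewrite /cx /cy /cz !mxE. Qed.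

Lemma coordZ a u :
  ((cx (a *: u) = (a * cx u)%R) * (cy (a *: u) = (a * cy u)%R) *
   (cz (a *: u) = (a * cz u)%R))%type.
Proof. by do !split; rewrite /cx /cy /cz !mxE. Qed.

Lemma coord0 : ((cx 0 = 0) * (cy 0 = 0) * (cz 0 = 0))%type.
Proof. by do !split; rewrite /cx /cy /cz !mxE. Qed.

Definition coordE := (coord_vec, coordD, coordN, coordZ, coord0).

Lemma dotvE u v : dotv u v = cx u * cx v + cy u * cy v + cz u * cz v.
Proof.
rewrite /dotv !big_ord_recl big_ord0 addr0 addrA /cx /cy /cz.
by congr (_ * _ + _ * _ + _ * _); congr (_ _ _); apply/val_inj.
Qed.

Lemma vec3P u v : cx u = cx v -> cy u = cy v -> cz u = cz v -> u = v.
Proof.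
move=> ex ey ez; apply/rowP => -[[|[|[|//]]] lt_i].
- by move: ex; rewrite /cx; congr (_ = _); congr (_ _ _); apply/val_inj.
- by move: ey; rewrite /cy; congr (_ = _); congr (_ _ _); apply/val_inj.
- by move: ez; rewrite /cz; congr (_ = _); congr (_ _ _); apply/val_inj.
Qed.

End Coordinates.

Ltac vring := apply: vec3P; rewrite ?(coordE, dotvE); ring.
Ltac sring := rewrite ?(coordE, dotvE); ring.

(** * Cross products and generic linear functionals *)

Section CrossProduct.
Variable R : realType.
Implicit Types (u v w d f g h k : 'rV[R]_3) (a b c t : R).

Lemma dotvv_eq0 u : (dotv u u == 0) = (u == 0).
Proof.
apply/eqP/eqP => [|->]; last by sring.
rewrite dotvE => e0.
have := sqr_ge0 (cx u); have := sqr_ge0 (cy u); have := sqr_ge0 (cz u).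
rewrite !expr2 => z2 y2 x2.
by apply: vec3P; rewrite coordE; apply/eqP; rewrite -sqrf_eq0 expr2; apply/eqP; lra.
Qed.

Lemma dotvC u v : dotv u v = dotv v u. Proof. sring. Qed.

Lemma dotvZl a u v : dotv (a *: u) v = a * dotv u v. Proof. sring. Qed.

Lemma dotvZr a u v : dotv u (a *: v) = a * dotv u v. Proof. sring. Qed.

Lemma dot0v v : dotv 0 v = 0. Proof. sring. Qed.

Lemma cross_eq0 d w : d != 0 -> cross d w = 0 -> exists t, w = t *: d.
Proof.
move=> d0 c0; exists (dotv d w / dotv d d).
have dd0 : dotv d d != 0 by rewrite dotvv_eq0.
have := congr1 (fun u => cross u d) c0.
(* The triple product expansion isolates [w] up to the factor [dotv d d]. *)
have -> : cross (cross d w) d = dotv d d *: w - dotv d w *: d by vring.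
have -> : cross 0 d = 0 by vring.
move/eqP; rewrite subr_eq0 => /eqP e.
by apply: (scalerI dd0); rewrite e scalerA mulrCA divff ?mulr1.
Qed.

Lemma crossZ a u v : cross (a *: u) v = a *: cross u v. Proof. vring. Qed.
Lemma crossZr a u v : cross u (a *: v) = a *: cross u v. Proof. vring. Qed.
Lemma crossvv u : cross u u = 0. Proof. vring. Qed.
Lemma crossC u v : cross u v = - cross v u. Proof. vring. Qed.
Lemma crossD u v w : cross u (v + w) = cross u v + cross u w. Proof. vring. Qed.

Lemma non_root (p : {poly R}) : p != 0 -> exists t, ~~ root p t.
Proof.
move=> p0; pose rs : seq R := [seq i%:R | i <- iota 0 (size p)].
have [/(max_poly_roots p0)|/allPn[t _ nt]] := boolP (all (root p) rs); last by exists t.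
rewrite map_inj_uniq ?iota_uniq; last by move=> i j /eqP; rewrite eqr_nat => /eqP.
by rewrite size_map size_iota ltnn => /(_ isT).
Qed.

(** On the moment curve [(1, t, t^2)] each nonzero [k] gives a nonzero polynomial in [t], and some
    [t] avoids the roots of their product. Generic projections are built from such functionals. *)
Lemma generic_functional (ks : seq 'rV[R]_3) :
  exists f, forall k, k \in ks -> k != 0 -> dotv f k != 0.
Proof.
pose p k : {poly R} := (cx k)%:P + (cy k)%:P * 'X + (cz k)%:P * 'X^2.
have p_neq0 k : k != 0 -> p k != 0.
  apply: contra => /eqP p0; apply/eqP/vec3P; rewrite coordE.
  - by have := congr1 (fun q : {poly R} => q`_0) p0;
      rewrite !coefD !coefCM !coefC !coefX !coefXn /= !mulr0 !addr0.
  - by have := congr1 (fun q : {poly R} => q`_1) p0;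
      rewrite !coefD !coefCM !coefC !coefX !coefXn /= mulr0 mulr1 addr0 add0r.
  - by have := congr1 (fun q : {poly R} => q`_2) p0;
      rewrite !coefD !coefCM !coefC !coefX !coefXn /= mulr0 mulr1 !add0r.
have prod0 : \prod_(k <- ks | k != 0) p k != 0.
  by rewrite prodf_seq_neq0; apply/allP => k _; apply/implyP/p_neq0.
have [t nt] := non_root prod0.
exists (vec 1 t (t ^+ 2)) => k kks k0; apply: contra nt => /eqP dk.
rewrite rootE horner_prod prodf_seq_eq0; apply/hasP; exists k => //.
rewrite k0 /= -dk dotvE !coordE /p 2!hornerD !hornerCM hornerC hornerX hornerXn.
by apply/eqP; ring.
Qed.

Lemma orthogonal_vector v : exists e, e != 0 /\ dotv e v = 0.
Proof.
have [z0|z0] := eqVneq (cz v) 0.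
  exists (vec 0 0 1); split; last by rewrite dotvE !coordE z0; ring.
  by apply/eqP => /(congr1 (@cz R)); rewrite !coordE => /eqP; rewrite oner_eq0.
exists (vec (- cz v) 0 (cx v)); split; last by sring.
by apply/eqP => /(congr1 (@cx R)); rewrite !coordE => /eqP; rewrite oppr_eq0 (negPf z0).
Qed.

End CrossProduct.

(** * Lines spanned by a point set *)

Section Lines.
Variables (R : realType) (V : finType) (pos : V -> 'rV[R]_3).
Hypothesis posI : injective pos.
Implicit Types (y z w : V) (S : {set V}) (a b : nat).

Definition line y z : {set V} := [set w | cross (pos z - pos y) (pos w - pos y) == 0].

(** The strict inequality leaves at least [a] points of the line besides any given one. *)
Definition lines a : {set {set V}} :=
  [set S : {set V} | (a < #|S|)%N &&
     [exists y, exists z, (y != z) && (S == line y z)]].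

Lemma line_left y z : y \in line y z.
Proof. by rewrite inE subrr; apply/eqP; vring. Qed.

Lemma line_right y z : z \in line y z.
Proof. by rewrite inE crossvv. Qed.

(** The vector of one chosen spanning pair, hence fixed only up to a scalar: lines are compared
    through [cross]. The default 0 is never met on members of [lines]. *)
Definition dir S : 'rV[R]_3 :=
  if [pick p : V * V | (p.1 != p.2) && (S == line p.1 p.2)] is Some p
  then pos p.2 - pos p.1 else 0.

Definition base S (y0 : V) : V := odflt y0 [pick y in S].

Lemma linesP a S : S \in lines a ->
  [/\ (a < #|S|)%N, dir S != 0, exists y z, dir S = pos z - pos y &
      forall y, y \in S -> forall w, (w \in S) = (cross (dir S) (pos w - pos y) == 0)].
Proof.
rewrite inE => /andP[aS /existsP[y0 /existsP[z0 yz0]]].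
rewrite /dir; case: pickP => [[y z] /= /andP[yz /eqP SE]|/(_ (y0, z0))]; last by rewrite yz0.
have d0 : pos z - pos y != 0 by rewrite subr_eq0 (inj_eq posI) eq_sym.
split=> //; first by exists y, z.
move=> u; rewrite SE inE => /eqP cu w; rewrite inE; congr (_ == _).
have -> : pos w - pos y = (pos w - pos u) + (pos u - pos y) by rewrite addrA subrK.
by rewrite crossD cu addr0.
Qed.

Lemma line_in_lines y z : y != z -> line y z \in lines 1.
Proof.
move=> yz; rewrite inE; apply/andP; split.
  apply/card_gt1P; exists y, z.
  by split; [exact: line_left|exact: line_right|].
by apply/existsP; exists y; apply/existsP; exists z; rewrite yz eqxx.
Qed.

Lemma dir_inj a b S S' y : S \in lines a -> S' \in lines b -> y \in S -> y \in S' ->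
  cross (dir S) (dir S') = 0 -> S = S'.
Proof.
move=> /linesP[_ d0 _ memS] /linesP[_ d0' _ memS'] yS yS' c0.
have [t dt] := cross_eq0 d0 c0.
have t0 : t != 0 by apply: contra d0'; rewrite dt => /eqP->; rewrite scale0r.
apply/setP => w; rewrite (memS y yS) (memS' y yS') dt crossZ scaler_eq0.
by rewrite (negPf t0).
Qed.

Lemma dir_param a S y w : S \in lines a -> y \in S -> w \in S ->
  exists t, pos w - pos y = t *: dir S.
Proof.
move=> /linesP[_ d0 _ memS] yS; rewrite (memS y yS) => /eqP.
exact: cross_eq0.
Qed.

Lemma lines_eq a b S S' y w : S \in lines a -> S' \in lines b ->
  y != w -> y \in S -> w \in S -> y \in S' -> w \in S' -> S = S'.
Proof.
move=> Sa Sb yw yS wS yS' wS'.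
have [t et] := dir_param Sa yS wS; have [t' et'] := dir_param Sb yS' wS'.
have wy : pos w - pos y != 0 by rewrite subr_eq0 (inj_eq posI) eq_sym.
have t0 : t != 0 by apply: contra wy; rewrite et => /eqP->; rewrite scale0r.
have t0' : t' != 0 by apply: contra wy; rewrite et' => /eqP->; rewrite scale0r.
apply: (dir_inj Sa Sb yS yS').
have : cross (t *: dir S) (t' *: dir S') = 0 by rewrite -et -et' crossvv.
rewrite crossZ crossZr => /eqP.
by rewrite !scaler_eq0 (negPf t0) (negPf t0') /= => /eqP.
Qed.

Definition inc_lines a : {set V * {set V}} :=
  [set e in setX [set: V] (lines a) | e.1 \in e.2].

Definition lines_at a y : {set {set V}} := [set S in lines a | y \in S].

(** A generic projection to the plane with coordinates [f] and [g] carries incidences to incidences.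
    [f] separates the points and so makes no line vertical; [g] gives nonparallel lines different
    slopes. *)
Lemma rich_lines_incidences a q :
  (q.+1 ^ 2 * #|inc_lines a| <=
   q.+1 ^ 2 * #|lines a| + 3 * q.+1 ^ 3 * #|V| + #|lines a| ^ 2)%N.
Proof.
have [f fP] := generic_functional
  ([seq pos p.2 - pos p.1 | p <- enum {: V * V}]).
have fpos y z : y != z -> dotv f (pos z - pos y) != 0.
  move=> yz; apply: fP; last by rewrite subr_eq0 (inj_eq posI) eq_sym.
  by apply/mapP; exists (y, z); rewrite ?mem_enum.
have fdir S : S \in lines a -> dotv f (dir S) != 0.
  move=> /linesP[_ d0 [y [z e]] _]; rewrite e; apply: fpos.
  by apply: contra d0 => /eqP yz; rewrite e yz subrr.
(* Killed by [f], and zero only for parallel directions; on it [g] takes the difference of the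
   slopes up to a nonzero factor. *)
pose k S S' := dotv f (dir S') *: dir S - dotv f (dir S) *: dir S'.
have [g gP] := generic_functional [seq k p.1 p.2 | p <- enum {: {set V} * {set V}}].
case: (pickP (@predT V)) => [y0 _|V0]; last first.
  suff -> : #|inc_lines a| = 0%N by rewrite muln0.
  apply/eqP; rewrite cards_eq0; apply/set0Pn => -[[y S] _].
  by have := V0 y.
pose s S := dotv g (dir S) / dotv f (dir S).
pose c S := dotv g (pos (base S y0)) - s S * dotv f (pos (base S y0)).
rewrite -cardsT.
apply: (@szemeredi_trotter R _ _ (fun y => dotv f (pos y)) (fun y => dotv g (pos y)) s c
  (fun y S => y \in S)) => [y z _ _ e|y S _ Sa yS|y S S' _ Sa S'a yS yS' e].
- apply/eqP/negPn/negP => yz; have := fpos y z yz; case/eqP.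
  have -> : dotv f (pos z - pos y) = dotv f (pos z) - dotv f (pos y) by sring.
  by rewrite e subrr.
- have bS : base S y0 \in S by rewrite /base; case: pickP => [//|/(_ y)]; rewrite yS.
  have [t et] := dir_param Sa bS yS.
  rewrite /c; have -> : pos y = pos (base S y0) + t *: dir S by rewrite -et addrC subrK.
  move: (pos (base S y0)) => p.
  have -> : dotv g (p + t *: dir S) = dotv g p + t * dotv g (dir S) by sring.
  have -> : dotv f (p + t *: dir S) = dotv f p + t * dotv f (dir S) by sring.
  by rewrite /s; field; apply: fdir.
apply: (dir_inj Sa S'a yS yS').
have [k0|k0] := eqVneq (k S S') 0; last first.
  have /gP/(_ k0) : k S S' \in [seq k p.1 p.2 | p <- enum {: {set V} * {set V}}].
    by apply/mapP; exists (S, S'); rewrite ?mem_enum.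
  case/eqP; have -> : dotv g (k S S') =
     dotv f (dir S') * dotv g (dir S) - dotv f (dir S) * dotv g (dir S') by rewrite /k; sring.
  apply/eqP; rewrite subr_eq0; move/eqP: e; rewrite /s eqr_div ?fdir //.
  by rewrite mulrC [X in _ == X -> _]mulrC.
have := congr1 (fun u => cross u (dir S')) k0.
have -> : cross (k S S') (dir S') = dotv f (dir S') *: cross (dir S) (dir S').
  by rewrite /k; vring.
have -> : cross 0 (dir S') = 0 by vring.
by move/eqP; rewrite scaler_eq0 (negPf (fdir _ S'a)) => /eqP.
Qed.

Definition perp_at a b y : {set {set V} * {set V}} :=
  [set p in setX (lines_at a y) (lines_at b y) | dotv (dir p.1) (dir p.2) == 0].

(** Up to the factor [dotv g g], the basis reciprocal to [f], [h], [g] is [cross h g], [cross g f],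
    [g]. Paired with a direction, the expansion turns perpendicularity into a linear equation. *)
Lemma reciprocal_basis (f h v : 'rV[R]_3) : let g := cross f h in
  dotv g g *: v = dotv v (cross h g) *: f + dotv v (cross g f) *: h + dotv v g *: g.
Proof. by move=> g; rewrite /g; vring. Qed.

(* The lines of the bundle at [y] are the points of a projective plane and their
   orthogonal planes its lines; [f], [h] and [g] are generic homogeneous
   coordinates with [f] sent to infinity. *)
Lemma perp_at_incidences a b y q :
  (q.+1 ^ 2 * #|perp_at a b y| <=
   q.+1 ^ 2 * #|lines_at b y| + 3 * q.+1 ^ 3 * #|lines_at a y| + #|lines_at b y| ^ 2)%N.
Proof.
(* A vector [e S] orthogonal to [dir S] detects parallelism: once [dotv f (e S)] is nonzero, [f] is
   not parallel to [dir S], and [h] can be chosen to keep [dotv (dir S) g] from vanishing. *)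
have orth v : exists e : 'rV[R]_3, e != 0 /\ dotv e v = 0 by exact: orthogonal_vector.
have [e eP] := choice (fun S : {set V} => orth (dir S)).
have [f fP] := generic_functional
  ([seq dir T | T <- enum {: {set V}}] ++ [seq e T | T <- enum {: {set V}}]).
have fdir c S : S \in lines c -> dotv f (dir S) != 0.
  move=> /linesP[_ d0 _ _]; apply: fP => //.
  by rewrite mem_cat map_f // mem_enum.
have fe S : dotv f (e S) != 0.
  by apply: fP; rewrite ?(eP S).1 // mem_cat [X in _ || X]map_f ?orbT // mem_enum.
pose k S S' := dotv f (dir S') *: dir S - dotv f (dir S) *: dir S'.
have [h hP] := generic_functional
  ([seq cross (dir T) f | T <- enum {: {set V}}] ++
   [seq k p.1 p.2 | p <- enum {: {set V} * {set V}}]).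
pose g := cross f h.
have gdir c S : S \in lines c -> dotv (dir S) g != 0.
  move=> /linesP[_ d0 _ _]; have -> : dotv (dir S) g = dotv h (cross (dir S) f).
    by rewrite /g; sring.
  apply: hP.
    by rewrite mem_cat; apply/orP; left; apply/mapP; exists S; rewrite ?mem_enum.
  apply/eqP => /(cross_eq0 d0)[t ft]; case/eqP: (fe S).
  have -> : dotv f (e S) = t * dotv (e S) (dir S) by rewrite ft; sring.
  by rewrite (eP S).2 mulr0.
have inat c S : S \in lines_at c y -> S \in lines c by rewrite inE => /andP[].
have aty c S : S \in lines_at c y -> y \in S by rewrite inE => /andP[].
(* Affine coordinates [x], [z] of a direction, and slope [s] and intercept [c] of the trace of the
   plane orthogonal to it; the choice of [f] and [h] makes the denominators nonzero. *)
pose x S := dotv h (dir S) / dotv f (dir S).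
pose z S := dotv g (dir S) / dotv f (dir S).
pose s S := - (dotv (dir S) (cross g f) / dotv (dir S) g).
pose c S := - (dotv (dir S) (cross h g) / dotv (dir S) g).
have incE S S' : S \in lines a -> S' \in lines b -> dotv (dir S) (dir S') == 0 ->
    z S = s S' * x S + c S'.
  move=> Sa S'b /eqP perp.
  have := congr1 (dotv (dir S)) (reciprocal_basis f h (dir S')); rewrite -/g /=.
  have -> : dotv (dir S) (dotv g g *: dir S') = dotv g g * dotv (dir S) (dir S') by sring.
  rewrite perp mulr0 /z /s /c /x.
  have p30 := gdir _ _ S'b; have f0 := fdir _ _ Sa.
  move: (dotv (dir S') (cross h g)) (dotv (dir S') (cross g f)) (dotv (dir S') g) p30.
  move=> p1 p2 p3 p30.
  have -> : dotv (dir S) (p1 *: f + p2 *: h + p3 *: g) =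
    p1 * dotv f (dir S) + p2 * dotv h (dir S) + p3 * dotv g (dir S) by sring.
  move: (dotv f (dir S)) (dotv h _) (dotv g _) f0 => F H G F0 lin.
  apply/eqP; rewrite -subr_eq0; apply/eqP.
  have -> : G / F - (- (p2 / p3) * (H / F) - p1 / p3) =
    (p1 * F + p2 * H + p3 * G) / (F * p3) by field; rewrite F0 p30.
  by rewrite -lin mul0r.
apply: (@szemeredi_trotter R _ _ x z s c (fun S S' => dotv (dir S) (dir S') == 0))
  => [S S' Sy S'y exS|S S' Sy S'y|S S1 S2 Sy S1y S2y inc1 inc2 es].
- apply: (dir_inj (inat _ _ Sy) (inat _ _ S'y) (aty _ _ Sy) (aty _ _ S'y)).
  have f0 := fdir _ _ (inat _ _ Sy); have f0' := fdir _ _ (inat _ _ S'y).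
  have k0 : k S S' = 0.
    apply/eqP/negPn/negP => k0; have : dotv h (k S S') != 0.
      apply: hP => //; rewrite mem_cat; apply/orP; right.
      by apply/mapP; exists (S, S'); rewrite ?mem_enum.
    case/eqP; have -> : dotv h (k S S') =
      dotv f (dir S') * dotv h (dir S) - dotv f (dir S) * dotv h (dir S').
      by rewrite /k; sring.
    apply/eqP; rewrite subr_eq0; move/eqP: exS; rewrite /x eqr_div //.
    by rewrite mulrC [X in _ == X -> _]mulrC.
  have := congr1 (fun u => cross u (dir S')) k0.
  have -> : cross (k S S') (dir S') = dotv f (dir S') *: cross (dir S) (dir S').
    by rewrite /k; vring.
  have -> : cross 0 (dir S') = 0 by vring.
  by move/eqP; rewrite scaler_eq0 (negPf f0') => /eqP.
- exact: incE (inat _ _ Sy) (inat _ _ S'y).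
apply: (dir_inj (inat _ _ S1y) (inat _ _ S2y) (aty _ _ S1y) (aty _ _ S2y)).
have ec : c S1 = c S2.
  have := incE _ _ (inat _ _ Sy) (inat _ _ S1y) inc1.
  by rewrite (incE _ _ (inat _ _ Sy) (inat _ _ S2y) inc2) es => /addrI.
have g1 := gdir _ _ (inat _ _ S1y); have g2 := gdir _ _ (inat _ _ S2y).
have gg : dotv g g != 0.
  rewrite dotvv_eq0; apply: contra g1 => /eqP->; rewrite dotvC dot0v //.
move: es ec; rewrite /s /c => /oppr_inj/eqP; rewrite eqr_div // => /eqP es.
move=> /oppr_inj/eqP; rewrite eqr_div // => /eqP ec.
(* [w] is orthogonal to [g] by construction, and equal intercepts and slopes make it orthogonal to
   [cross h g] and [cross g f]; the reciprocal expansion then gives [w = 0]. *)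
pose w := dotv (dir S2) g *: dir S1 - dotv (dir S1) g *: dir S2.
have w0 : w = 0.
  apply: (scalerI gg); rewrite reciprocal_basis scaler0 -/g.
  have wE u : dotv w u = dotv (dir S2) g * dotv (dir S1) u - dotv (dir S1) g * dotv (dir S2) u.
    by rewrite /w; sring.
  have w_eq0 u : dotv (dir S1) u * dotv (dir S2) g = dotv (dir S2) u * dotv (dir S1) g ->
      dotv w u = 0 by rewrite wE mulrC => ->; rewrite mulrC subrr.
  by rewrite (w_eq0 _ ec) (w_eq0 _ es) (w_eq0 g (mulrC _ _)) !scale0r !addr0.
have := congr1 (fun u => cross u (dir S2)) w0.
have -> : cross w (dir S2) = dotv (dir S2) g *: cross (dir S1) (dir S2).
  by rewrite /w; vring.
have -> : cross 0 (dir S2) = 0 by vring.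
by move/eqP; rewrite scaler_eq0 (negPf g2) => /eqP.
Qed.

End Lines.

(** * Counting right angles *)

Lemma card_dep_pairs (T U : finType) (A : {set T}) (F : T -> {set U}) :
  #|[set p : T * U | (p.1 \in A) && (p.2 \in F p.1)]| = (\sum_(a in A) #|F a|)%N.
Proof.
under [RHS]eq_bigr => a _ do rewrite -sum1_card.
rewrite pair_big_dep /= -sum1_card; apply: eq_bigl => -[a u].
by rewrite inE.
Qed.

(* The optimal sampling rate [q] is about [sqrt (2 L / a)]. *)
Lemma rich_lines_arith a n I L : (0 < a)%N -> (a ^ 2 <= 64 * n)%N -> (a.+1 * L <= I)%N ->
  (forall q, q.+1 ^ 2 * I <= q.+1 ^ 2 * L + 3 * q.+1 ^ 3 * n + L ^ 2)%N ->
  (a ^ 2 * I <= 1152 * n ^ 2)%N.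
Proof.
move=> a0 an aL bound.
have ex : exists q, (2 * L <= a * q.+1 ^ 2)%N by exists (2 * L)%N; nia.
case: (ex_minnP ex) => q Lq qmin.
(* After division by [q.+1 ^ 2] the choice of [q] makes the quadratic term at most half of [a * L],
   and [a.+1 * L <= I] lets it be absorbed into the left-hand side. *)
have I12 : (I <= 12 * q.+1 * n)%N.
  have : (2 * I <= 2 * L + 6 * q.+1 * n + a * L)%N.
    have Q0 : (0 < q.+1 ^ 2)%N by rewrite expn_gt0.
    rewrite -(leq_pmul2l Q0); have := bound q; have := leq_mul Lq (leqnn L).
    move: (q.+1) => r; nia.
  nia.
case: q Lq qmin I12 => [|q] Lq qmin I12; first nia.
have : ~~ (2 * L <= a * q.+1 ^ 2)%N by apply/negP => /qmin; rewrite ltnn.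
rewrite -ltnNge => Lq'.
(* Minimality of [q] bounds it from above, since one step less fails and [q.+2 <= 2 * q.+1]. This
   leads to the factor 96, and [1152 = 12 * 96]. *)
have aq : (a * q.+2 ^ 2 <= 8 * L)%N by nia.
have aq2 : (a ^ 2 * q.+2 <= 96 * n)%N.
  have r0 : (0 < q.+2)%N by [].
  rewrite -(leq_pmul2r r0); have := leq_mul (leqnn a) aq; nia.
have := leq_mul aq2 (leqnn n); have := leq_mul (leqnn (a ^ 2)%N) I12.
nia.
Qed.

(** For [w > 0] the largest power of 8 up to [w] already exceeds [w / 8]. Sizes can thus be sorted
    by the thresholds [8 ^ i <= w] instead of exact classes. *)
Lemma layers w J : (w < 8 ^ J)%N -> (w <= 8 * \sum_(i < J) (8 ^ i <= w)%N * 8 ^ i)%N.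
Proof.
elim: J => [|J IHJ]; first by rewrite expn0; case: w.
rewrite big_ord_recr /= mulnDr expnS => lt.
have [le|lt'] := leqP (8 ^ J) w; last by rewrite mul0n muln0 addn0 IHJ.
by rewrite mul1n (leq_trans (ltnW lt)) ?leq_addl.
Qed.

Section Counting.
Variables (R : realType) (V : finType) (pos : V -> 'rV[R]_3).
Hypothesis posI : injective pos.
Implicit Types (x y z w : V) (a b : nat).

Local Notation lines := (lines pos).
Local Notation lines_at := (lines_at pos).
Local Notation inc_lines := (inc_lines pos).
Local Notation perp_at := (perp_at pos).
Local Notation line := (line pos).
Local Notation dir := (dir pos).

Lemma in_lines_at a y S : (S \in lines_at a y) = (S \in lines a) && (y \in S).
Proof. by rewrite in_set. Qed.

Lemma sum_lines_at a : (\sum_y #|lines_at a y|)%N = #|inc_lines a|.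
Proof.
have -> : (\sum_y #|lines_at a y| = \sum_(y in [set: V]) #|lines_at a y|)%N.
  by apply: eq_bigl => y; rewrite inE.
rewrite -card_dep_pairs; apply: eq_card => -[y S]; rewrite !inE /=; congr (_ && _).
Qed.

Lemma card_lines_le a : (a.+1 * #|lines a| <= #|inc_lines a|)%N.
Proof.
have -> : #|inc_lines a| = (\sum_(S in lines a) #|S|)%N.
  rewrite -card_dep_pairs.
  have swapI : injective (fun p : V * {set V} => (p.2, p.1)) by move=> [? ?] [? ?] [-> ->].
  rewrite -(card_imset _ swapI); apply: eq_card => -[S y]; rewrite inE /=.
  apply/imsetP/andP => [[[y' S'] e [-> ->]]|[Sa yS]].
    by move: e; rewrite !inE => /andP[].
  by exists (y, S); rewrite // inE /= yS andbT inE /= Sa inE.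
rewrite mulnC -sum_nat_const; apply: leq_sum => S.
by rewrite inE => /andP[].
Qed.

(** Distinct lines through [y] have no other point in common, and each carries at least [a] points
    besides [y]. *)
Lemma card_lines_at a y : (a * #|lines_at a y| <= #|V|)%N.
Proof.
apply: (@leq_trans (\sum_(S in lines_at a y) #|S :\ y|)).
  rewrite mulnC -sum_nat_const; apply: leq_sum => S; rewrite inE => /andP[Sa yS].
  by move: Sa; rewrite inE => /andP[+ _]; rewrite (cardsD1 y) yS.
rewrite -card_dep_pairs -cardsT.
apply: (@card_le_rel _ _ _ _ (fun p w => p.2 = w)) => [[S w] _|[S w] [S' w'] w0].
  by exists w.
rewrite in_set /= in_lines_at in_setD1 => /andP[/andP[Sa yS] /andP[wy wS]].
rewrite in_set /= in_lines_at in_setD1 => /andP[/andP[Sa' yS'] /andP[_ wS']].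
move=> <- e; subst w'; congr (_, _).
exact: (@lines_eq _ _ _ posI a a _ _ w y).
Qed.

Lemma rich_lines a : (0 < a)%N -> (a ^ 2 <= 64 * #|V|)%N ->
  (a ^ 2 * #|inc_lines a| <= 1152 * #|V| ^ 2)%N.
Proof.
move=> a0 aV; apply: (rich_lines_arith a0 aV (card_lines_le a)) => q.
exact: rich_lines_incidences.
Qed.

Definition rights : {set V * V * V} :=
  [set t : V * V * V | let: (x, y, z) := t in
    [&& x != y, z != y & dotv (pos x - pos y) (pos z - pos y) == 0]].

Lemma in_rights x y z : ((x, y, z) \in rights) =
  [&& x != y, z != y & dotv (pos x - pos y) (pos z - pos y) == 0].
Proof. by rewrite in_set. Qed.

(* On a fixed line, the apex is the foot of the perpendicular from the end point [x]. *)
Lemma foot_uniq a S x y y' z z' :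
  S \in lines a -> y \in S -> z \in S -> y' \in S -> z' \in S ->
  z != y -> z' != y' -> dotv (pos x - pos y) (pos z - pos y) = 0 ->
  dotv (pos x - pos y') (pos z' - pos y') = 0 -> y = y'.
Proof.
move=> Sa yS zS yS' zS' zy zy'.
have [t et] := dir_param posI Sa yS zS; have [t' et'] := dir_param posI Sa yS' zS'.
have [r er] := dir_param posI Sa yS yS'.
have t0 : t != 0.
  apply: contra zy => /eqP t0; move/eqP: et.
  by rewrite t0 scale0r subr_eq0 (inj_eq posI).
have t0' : t' != 0.
  apply: contra zy' => /eqP t0'; move/eqP: et'.
  by rewrite t0' scale0r subr_eq0 (inj_eq posI).
have [_ d0 _ _] := linesP posI Sa.
rewrite et et' !dotvZr => /eqP; rewrite mulf_eq0 (negPf t0) /= => /eqP e1.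
move=> /eqP; rewrite mulf_eq0 (negPf t0') /= => /eqP e2.
have : dotv (pos y' - pos y) (dir S) = 0.
  have -> : pos y' - pos y = (pos x - pos y) - (pos x - pos y').
    by rewrite opprB [RHS]addrC -addrA addKr addrC.
  have -> : dotv (pos x - pos y - (pos x - pos y')) (dir S) =
    dotv (pos x - pos y) (dir S) - dotv (pos x - pos y') (dir S) by sring.
  by rewrite e1 e2 subrr.
rewrite er dotvZl => /eqP; rewrite mulf_eq0 dotvv_eq0 (negPf d0) orbF => /eqP r0.
by apply/esym/posI/eqP; rewrite -subr_eq0 er r0 scale0r.
Qed.

Lemma mem_lines_gt a y z : y != z -> (a < #|line y z|)%N -> line y z \in lines a.
Proof. by move=> yz alt; have := line_in_lines pos yz; rewrite !inE alt => /andP[]. Qed.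

(** The end [x] and the incidence of [z] with the line determine the apex, as the foot of the
    perpendicular from [x]. *)
Lemma rights_high a :
  (#|[set t in rights | (a < #|line t.1.2 t.2|)%N]| <= #|V| * #|inc_lines a|)%N.
Proof.
rewrite -cardsT -cardsX.
apply: (@card_le_rel _ _ _ _ (fun t p => p = (t.1.1, (t.2, line t.1.2 t.2))))
  => [[[x y] z]|[[x y] z] [[x' y'] z'] p].
  rewrite in_set in_rights /= => /andP[/and3P[xy zy _] alt].
  exists (x, (z, line y z)) => //; rewrite in_setX in_setT /= in_set in_setX in_setT /=.
  by rewrite mem_lines_gt ?line_right // eq_sym.
rewrite in_set in_rights /= => /andP[/and3P[xy zy /eqP perp] alt].
rewrite in_set in_rights /= => /andP[/and3P[xy' zy' /eqP perp'] alt'].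
move=> -> [ex ez el]; subst x' z'; congr (_, _, _).
have yz : y != z by rewrite eq_sym.
apply: (@foot_uniq a (line y z) x y y' z z) => //; first exact: mem_lines_gt.
- exact: line_left.
- exact: line_right.
- by rewrite el; exact: line_left.
- exact: line_right.
Qed.

Lemma rights_high_sym a :
  (#|[set t in rights | (a < #|line t.1.2 t.1.1|)%N]| <= #|V| * #|inc_lines a|)%N.
Proof.
apply: leq_trans (rights_high a).
apply: (@card_le_rel _ _ _ _ (fun t s => s = (t.2, t.1.2, t.1.1)))
  => [[[x y] z]|[[x y] z] [[x' y'] z'] p].
  rewrite in_set in_rights /= => /andP[/and3P[xy zy perp] alt].
  by exists (z, y, x); rewrite // in_set in_rights /= zy xy dotvC perp.
by move=> _ _ -> [-> -> ->].
Qed.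

Lemma card_perp_sym a b y : #|perp_at a b y| = #|perp_at b a y|.
Proof.
have swapI : injective (fun p : {set V} * {set V} => (p.2, p.1)) by move=> [? ?] [? ?] [-> ->].
rewrite -(card_imset _ swapI); apply: eq_card => -[S S'].
apply/imsetP/idP => [[[U U'] + [-> ->]]|]; rewrite !inE.
  by rewrite dotvC => /andP[/andP[-> ->] ->].
by move=> e; exists (S', S); rewrite // !inE /= dotvC; move: e => /andP[/andP[-> ->] ->].
Qed.

End Counting.

(** * Right triples on lines with few points *)

Section LowLines.
Variables (R : realType) (V : finType) (pos : V -> 'rV[R]_3).
Hypothesis posI : injective pos.
Implicit Types (x y z w : V) (a b : nat) (S : {set V}).

Local Notation lines := (lines pos).
Local Notation lines_at := (lines_at pos).
Local Notation inc_lines := (inc_lines pos).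
Local Notation perp_at := (perp_at pos).
Local Notation line := (line pos).
Local Notation dir := (dir pos).
Local Notation rights := (rights pos).

Lemma in_perp_at a b y (S S' : {set V}) : ((S, S') \in perp_at a b y) =
  [&& (S \in lines a) && (y \in S), (S' \in lines b) && (y \in S') &
      dotv (dir S) (dir S') == 0].
Proof. by rewrite in_set in_setX /= !in_lines_at -!andbA. Qed.

(** The local incidence bound is multiplied by [b] and summed over the apices; one factor of
    [#|lines_at b y| ^ 2] is bounded through [b * #|lines_at b y| <= #|V|]. *)
Lemma sum_perp_at a b q :
  (b * q.+1 ^ 2 * (\sum_y #|perp_at a b y|) <=
   b * q.+1 ^ 2 * #|inc_lines b| + 3 * b * q.+1 ^ 3 * #|inc_lines a| +
   #|V| * #|inc_lines b|)%N.
Proof.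
rewrite -(sum_lines_at pos a) -(sum_lines_at pos b) !big_distrr -!big_split /=.
apply: leq_sum => y _.
have := leq_mul (leqnn b) (perp_at_incidences posI a b y q).
have := leq_mul (card_lines_at posI b y) (leqnn #|lines_at b y|).
move: #|lines_at b y| #|lines_at a y| #|perp_at a b y| #|V| (q.+1) => Nb Na P n r.
nia.
Qed.

Let small m := [set t in rights | (#|line t.1.2 t.1.1| <= m)%N && (#|line t.1.2 t.2| <= m)%N].

Let lines_ge a S : (0 < a)%N -> S \in lines 1 -> (a <= #|S|.-1)%N -> S \in lines a.
Proof.
move=> a0; rewrite !in_set => /andP[S1 ->]; rewrite andbT.
by case: #|S| S1.
Qed.

Let fibre y (S S' : {set V}) : (y \in S) -> (y \in S') ->
  (#|[set t in rights | (t.1.2, (line t.1.2 t.1.1, line t.1.2 t.2)) == (y, (S, S'))]| <=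
   #|S|.-1 * #|S'|.-1)%N.
Proof.
move=> yS yS'.
have -> : #|S|.-1 = #|S :\ y| by rewrite (cardsD1 y) yS.
have -> : #|S'|.-1 = #|S' :\ y| by rewrite (cardsD1 y) yS'.
rewrite -cardsX.
apply: (@card_le_rel _ _ _ _ (fun t p => p = (t.1.1, t.2)))
  => [[[x y'] z]|[[x y1] z] [[x' y2] z'] p].
  rewrite in_set in_rights /= => /andP[/and3P[xy zy _] /eqP[<- <- <-]].
  exists (x, z) => //; rewrite in_setX !in_setD1 xy zy /=.
  by apply/andP; split; exact: line_right.
rewrite in_set => /andP[_ /eqP[/= -> _ _]].
by rewrite in_set => /andP[_ /eqP[/= -> _ _]] -> [-> ->].
Qed.

(** Triples are grouped by apex and pair of lines. Given these, the ends vary over the other points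
    of each line, and replacing both sizes by thresholds costs [8 * 8 = 64]. *)
Lemma rights_low J : (#|small (8 ^ J)| <= 64 * \sum_(i < J) \sum_(j < J)
    8 ^ i * 8 ^ j * (\sum_y #|perp_at (8 ^ i) (8 ^ j) y|))%N.
Proof.
pose K : {set V * ({set V} * {set V})} := [set k | [&& k.2 \in perp_at 1 1 k.1,
  (#|k.2.1| <= 8 ^ J)%N & (#|k.2.2| <= 8 ^ J)%N]].
pose key (t : V * V * V) := (t.1.2, (line t.1.2 t.1.1, line t.1.2 t.2)).
have keyK t : t \in small (8 ^ J) -> key t \in K.
  case: t => [[x y] z]; rewrite in_set in_rights => /andP[/and3P[xy zy perp] /andP[l1 l2]].
  rewrite in_set l1 l2 !andbT in_perp_at /=.
  have yx : y != x by rewrite eq_sym.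
  have yz : y != z by rewrite eq_sym.
  have Lx := line_in_lines pos yx; have Lz := line_in_lines pos yz.
  have yLx : y \in line y x by exact: line_left.
  have yLz : y \in line y z by exact: line_left.
  have [r er] := dir_param posI Lx yLx (line_right _ _ _).
  have [t et] := dir_param posI Lz yLz (line_right _ _ _).
  have r0 : r != 0.
    apply: contra xy => /eqP r0; move/eqP: er.
    by rewrite r0 scale0r subr_eq0 (inj_eq posI).
  have t0 : t != 0.
    apply: contra zy => /eqP t0; move/eqP: et.
    by rewrite t0 scale0r subr_eq0 (inj_eq posI).
  rewrite Lx Lz yLx yLz /=; move: perp; rewrite er et dotvZl dotvZr.
  by rewrite !mulf_eq0 (negPf r0) (negPf t0).
have -> : #|small (8 ^ J)| = (\sum_(k in K) #|[set t in small (8 ^ J) | key t == k]|)%N.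
  rewrite -sum1_card (partition_big key (mem K)) //=.
  by apply: eq_bigr => k _; rewrite -sum1_card; apply: eq_bigl => t; rewrite in_set.
pose wt S := (\sum_(i < J) (8 ^ i <= #|S : {set V}|.-1)%N * 8 ^ i)%N.
have le_wt (S : {set V}) : (#|S| <= 8 ^ J)%N -> (#|S|.-1 <= 8 * wt S)%N.
  move=> SJ; apply: layers; have : (0 < 8 ^ J)%N by rewrite expn_gt0.
  by move: SJ; move: #|S| (8 ^ J)%N => [|s] m //=; lia.
apply: (@leq_trans (\sum_(k in K) 64 * (wt k.2.1 * wt k.2.2))).
  apply: leq_sum => -[y [S S']]; rewrite in_set in_perp_at /=.
  move=> /and3P[/and3P[/andP[_ yS] /andP[_ yS'] _] SJ S'J].
  apply: (@leq_trans (#|S|.-1 * #|S'|.-1)).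
    apply: leq_trans (fibre yS yS'); apply/subset_leq_card/subsetP => t.
    by rewrite !in_set => /andP[/andP[-> _] ->].
  have := leq_mul (le_wt _ SJ) (le_wt _ S'J).
  by rewrite mulnACA.
rewrite -big_distrr leq_mul2l /=.
have -> : (\sum_(k in K) wt k.2.1 * wt k.2.2 = \sum_(i < J) \sum_(j < J) 8 ^ i * 8 ^ j *
   (\sum_(k in K) (8 ^ i <= #|k.2.1|.-1) * (8 ^ j <= #|k.2.2|.-1)))%N.
  under eq_bigr => k _ do rewrite /wt big_distrlr /=.
  rewrite exchange_big /=; apply: eq_bigr => i _.
  rewrite exchange_big /=; apply: eq_bigr => j _.
  by rewrite big_distrr /=; apply: eq_bigr => k _; rewrite mulnACA mulnC.
apply: leq_sum => i _; apply: leq_sum => j _; rewrite leq_mul2l; apply/orP; right.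
have -> : (\sum_y #|perp_at (8 ^ i) (8 ^ j) y| =
    \sum_(y in [set: V]) #|perp_at (8 ^ i) (8 ^ j) y|)%N.
  by apply: eq_bigl => y; rewrite in_setT.
have -> : (\sum_(k in K) (8 ^ i <= #|k.2.1|.-1) * (8 ^ j <= #|k.2.2|.-1) =
    #|[set k in K | (8 ^ i <= #|k.2.1|.-1) && (8 ^ j <= #|k.2.2|.-1)]|)%N.
  rewrite -sum1_card big_mkcond [RHS]big_mkcond; apply: eq_bigr => k _.
  by rewrite [in RHS]in_set mulnb; case: (k \in K) => //=; case: (_ && _).
rewrite -card_dep_pairs; apply/subset_leq_card/subsetP => -[y [S S']].
rewrite in_set => /andP[]; rewrite in_set in_perp_at /=.
move=> /and3P[/and3P[/andP[S1 yS] /andP[S'1 yS'] perp] _ _] /andP[li lj].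
have pow_gt0 k : (0 < 8 ^ k)%N by rewrite expn_gt0.
have Si := lines_ge (pow_gt0 i) S1 li; have S'j := lines_ge (pow_gt0 j) S'1 lj.
by rewrite in_set in_setT in_perp_at yS yS' perp Si S'j.
Qed.

Lemma card_rights J : (#|rights| <= 2 * (#|V| * #|inc_lines (8 ^ J)|) + #|small (8 ^ J)|)%N.
Proof.
have cover : rights \subset [set t in rights | (8 ^ J < #|line t.1.2 t.1.1|)%N] :|:
    [set t in rights | (8 ^ J < #|line t.1.2 t.2|)%N] :|: small (8 ^ J).
  apply/subsetP => t tR; rewrite 2!in_setU !(in_set (fun t => (t \in rights) && _)) tR /=.
  by case: leqP; case: leqP.
apply: leq_trans (subset_leq_card cover) _.
apply: leq_trans (leq_card_setU _ _) _; rewrite leq_add2r.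
apply: leq_trans (leq_card_setU _ _) _.
by rewrite mul2n -addnn leq_add ?rights_high ?rights_high_sym.
Qed.

End LowLines.

(** Lets the class of richer lines always come first; the diagonal is counted twice, which the
    inequality allows. *)
Lemma sum_symmetric (F : nat -> nat -> nat) J : (forall i j, F i j = F j i) ->
  (\sum_(i < J) \sum_(j < J) F i j <= 2 * \sum_(i < J) \sum_(j < i.+1) F i j)%N.
Proof.
move=> Fsym; elim: J => [|J IHJ]; first by rewrite !big_ord0.
rewrite big_ord_recr /= (big_ord_recr J (fun i => _)) /=.
have -> : (\sum_(i < J) \sum_(j < J.+1) F i j =
    \sum_(i < J) \sum_(j < J) F i j + \sum_(j < J) F J j)%N.
  rewrite -big_split /=; apply: eq_bigr => i _.
  by rewrite big_ord_recr /= (Fsym J).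
rewrite [in X in (_ <= X)%N](big_ord_recr J) /= (big_ord_recr J (fun j => F J j)) /=.
rewrite mulnDr -addnA leq_add //.
by rewrite mul2n -addnn -!addnA leq_add2l addnCA leq_add2l leq_addl.
Qed.

(** * Estimates for the sums over the layers *)

Section Numerics.
Variable R : realFieldType.

(** The rate [q = m * u ^+ 2 / b] balances the last two terms, which contribute [3 * m / u] and
    [m / u] times [K]; the first contributes [a / b]. Writing [a] as a cube keeps this rate
    rational. *)
Lemma layer_bound (a b u m n q P Ia Ib K : R) : 0 < u -> a = u ^+ 3 -> 0 < b -> 0 < m ->
  q * b = m * u ^+ 2 -> 0 <= n -> n <= m ^+ 3 -> 0 <= K ->
  b * q ^+ 2 * P <= b * q ^+ 2 * Ib + 3 * b * q ^+ 3 * Ia + n * Ib ->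
  a ^+ 2 * Ia <= K -> b ^+ 2 * Ib <= K ->
  a * b * P <= K * (a / b + 4 * m / u).
Proof.
move=> u0 ea b0 m0 qb n0 nm K0 le leA leB; subst a.
have u0' : u != 0 by rewrite gt_eqF.
have b0' : b != 0 by rewrite gt_eqF.
have m0' : m != 0 by rewrite gt_eqF.
have eq : q = m * u ^+ 2 / b by apply: (mulIf b0'); rewrite qb divfK.
have q0 : 0 < q by rewrite eq divr_gt0 // mulr_gt0 // exprn_gt0.
have q0' : q != 0 by rewrite gt_eqF.
have bq : 0 < b * q ^+ 2 by rewrite mulr_gt0 // exprn_gt0.
have t1 : u ^+ 3 * b * Ib <= u ^+ 3 / b * K.
  have -> : u ^+ 3 * b * Ib = u ^+ 3 / b * (b ^+ 2 * Ib) by field.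
  by rewrite ler_pM2l // divr_gt0 // exprn_gt0.
have t2 : u ^+ 3 * b * (3 * q * Ia) <= 3 * m / u * K.
  have -> : u ^+ 3 * b * (3 * q * Ia) = 3 * m / u * ((u ^+ 3) ^+ 2 * Ia).
    by rewrite eq; field; rewrite u0' b0'.
  by rewrite ler_pM2l // divr_gt0 // mulr_gt0.
have t3 : u ^+ 3 * b * (n * Ib / (b * q ^+ 2)) <= m / u * K.
  have -> : u ^+ 3 * b * (n * Ib / (b * q ^+ 2)) = n / (m ^+ 2 * u) * (b ^+ 2 * Ib).
    by rewrite eq; field; rewrite u0' b0' m0'.
  apply: le_trans (_ : n / (m ^+ 2 * u) * K <= _).
    by rewrite ler_wpM2l // divr_ge0 // mulr_ge0 ?exprn_ge0 // ltW.
  rewrite ler_wpM2r // ler_pdivrMr ?mulr_gt0 ?exprn_gt0 //.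
  by apply: le_trans nm _; rewrite le_eqVlt; apply/orP; left; apply/eqP; field.
have : P <= Ib + 3 * q * Ia + n * Ib / (b * q ^+ 2).
  rewrite -(ler_pM2l bq); apply: le_trans le _; rewrite le_eqVlt.
  by apply/orP; left; apply/eqP; field; rewrite b0' q0'.
have ub : 0 < u ^+ 3 * b by rewrite mulr_gt0 // exprn_gt0.
rewrite -(ler_pM2l ub) => /le_trans; apply; rewrite !mulrDr.
have -> : K * (u ^+ 3 / b) + K * (4 * m / u) =
  u ^+ 3 / b * K + 3 * m / u * K + m / u * K by field; rewrite u0' b0'.
by rewrite !lerD.
Qed.

(** [17 = 1 + 4 * 4]: the first summands are geometric, and in the second the [i.+1] choices of [j]
    are absorbed because the sum of [i.+1 / 2 ^ i] stays below 4. No logarithm is lost. *)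
Lemma layer_sum (J : nat) :
  \sum_(i < J) \sum_(j < i.+1) (8 ^+ i / 8 ^+ j + 4 * 8 ^+ J / 2 ^+ i) <= 17 * 8 ^+ J :> R.
Proof.
have p8 k : 0 < (8 : R) ^+ k by rewrite exprn_gt0.
have p2 k : 0 < (2 : R) ^+ k by rewrite exprn_gt0.
have geo k : \sum_(j < k) ((8 : R) ^+ j)^-1 <= 2 - 2 / 8 ^+ k.
  elim: k => [|k IHk]; first by rewrite big_ord0 expr0 divr1 subrr.
  rewrite big_ord_recr /= exprS invfM; have : 0 < ((8 : R) ^+ k)^-1 by rewrite invr_gt0.
  lra.
have s1 : \sum_(i < J) \sum_(j < i.+1) (8 ^+ i / 8 ^+ j) <= 8 ^+ J :> R.
  apply: le_trans (_ : \sum_(i < J) (2 * 8 ^+ i) <= _).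
    apply: ler_sum => i _; rewrite -mulr_sumr mulrC ler_pM2r //.
    apply: le_trans (geo _) _; have : 0 < ((8 : R) ^+ i.+1)^-1 by rewrite invr_gt0.
    lra.
  elim: J => [|k IHk]; first by rewrite big_ord0.
  by rewrite big_ord_recr /= exprS; have := p8 k; lra.
have s2 : \sum_(i < J) (i.+1%:R / 2 ^+ i) <= 4 :> R.
  have -> : \sum_(i < J) (i.+1%:R / 2 ^+ i) = 4 - 2 * J.+2%:R / 2 ^+ J :> R.
    elim: (J) => [|k IHk]; first by rewrite big_ord0 expr0 divr1; ring.
    rewrite big_ord_recr /= IHk exprS -(natr1 k.+2) -(natr1 k.+1); field.
    by rewrite gt_eqF ?p2.
  by rewrite gerBl divr_ge0 // ?mulr_ge0 // ltW.
under eq_bigr => i _ do rewrite big_split /=.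
rewrite big_split /=.
have -> : \sum_(i < J) \sum_(j < i.+1) (4 * 8 ^+ J / 2 ^+ i) =
    4 * 8 ^+ J * \sum_(i < J) (i.+1%:R / 2 ^+ i) :> R.
  rewrite mulr_sumr; apply: eq_bigr => i _.
  by rewrite sumr_const card_ord -mulr_natl; ring.
have := ler_wpM2l (ltW (p8 J)) s2; lra.
Qed.

End Numerics.

(** * The bound on the number of right triples *)

Section RightAngles.
Variables (R : realType) (V : finType) (pos : V -> 'rV[R]_3).
Hypothesis posI : injective pos.

(* [m] is a power of 8 of the order of [#|V| ^ (1 / 3)]. *)
Lemma card_rights_le : (1 < #|V|)%N -> exists m : nat, (m ^ 3 <= 512 * #|V|)%N /\
  (#|rights pos|%:R <= 1152 * 2178 * #|V|%:R ^+ 2 * m%:R :> R).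
Proof.
set n := #|V| => n1.
have ex : exists J, (n <= (8 ^ J) ^ 3)%N.
  exists n; apply: (leq_trans (ltnW (ltn_expl n (isT : (1 < 8)%N)))).
  by rewrite -expnM leq_exp2l // leq_pmulr.
(* Minimality gives both [n <= m ^ 3] and [(8 ^ J) ^ 3 < n], where [m = 8 * 8 ^ J]; the minimum is
   positive because [n > 1]. *)
case: (ex_minnP ex) => -[|J]; first by rewrite expn0; lia.
set m := (8 ^ J.+1)%N => nm Jmin; exists m.
have small_a i : (i <= J)%N -> ((8 ^ i) ^ 3 < n)%N.
  move=> iJ; apply: (@leq_ltn_trans ((8 ^ J) ^ 3)).
    by rewrite leq_exp2r // leq_exp2l.
  by rewrite ltnNge; apply/negP => /Jmin; rewrite ltnn.
have cube_sq k : (k ^ 3 < n -> k ^ 2 <= n)%N by case: k => [|k]; nia.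
have m8 : m = (8 * 8 ^ J)%N by rewrite /m expnS.
split; first by have := small_a J (leqnn J); rewrite m8 expnMn; lia.
(* [8 ^ i <= 8 * 8 ^ J] and [(8 ^ J) ^ 2 <= n] give the hypothesis [a ^ 2 <= 64 * n] of the bound
   for rich lines. *)
have rich i : (i <= J.+1)%N -> ((8 ^ i) ^ 2 * #|inc_lines pos (8 ^ i)| <= 1152 * n ^ 2)%N.
  move=> iJ; apply: rich_lines => //; first by rewrite expn_gt0.
  have := cube_sq _ (small_a J (leqnn J)); rewrite -/n => ?.
  apply: (@leq_trans ((8 * 8 ^ J) ^ 2)); first by rewrite leq_exp2r // -expnS leq_exp2l.
  by rewrite expnMn leq_mul.
have high : (n * #|inc_lines pos m| <= 1152 * n ^ 2 * m)%N.
  have m0 : (0 < m ^ 2)%N by rewrite !expn_gt0.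
  rewrite -(leq_pmul2l m0); have := leq_mul (leqnn n) (rich J.+1 (leqnn _)).
  have := leq_mul nm (leqnn (1152 * n ^ 2)%N); rewrite -/m; nia.
pose P i j := (8 ^ i * 8 ^ j * (\sum_y #|perp_at pos (8 ^ i) (8 ^ j) y|))%N.
have low : (\sum_(i < J.+1) \sum_(j < J.+1) P i j)%:R <=
    2 * (1152 * n%:R ^+ 2 * (17 * m%:R)) :> R.
  apply: (@le_trans _ _ (2 * \sum_(i < J.+1) \sum_(j < i.+1) P i j)%:R).
    rewrite ler_nat; apply: sum_symmetric => i j; rewrite /P.
    rewrite [X in (X * _)%N]mulnC; congr (_ * _)%N.
    by apply: eq_bigr => y _; exact: card_perp_sym.
  rewrite natrM ler_pM2l // natr_sum.
  have mE : m%:R = 8 ^+ J.+1 :> R by rewrite /m natrX.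
  apply: le_trans (_ : \sum_(i < J.+1) \sum_(j < i.+1)
     (1152 * n%:R ^+ 2) * (8 ^+ i / 8 ^+ j + 4 * 8 ^+ J.+1 / 2 ^+ i) <= _); last first.
    under eq_bigr => i _ do rewrite -mulr_sumr.
    rewrite -mulr_sumr ler_wpM2l ?mulr_ge0 ?exprn_ge0 // mE; exact: layer_sum.
  apply: ler_sum => i _; rewrite natr_sum; apply: ler_sum => j _.
  have iJ : (i <= J)%N by rewrite -ltnS.
  have ji : (j <= i)%N by rewrite -ltnS.
  (* The rate [m * u ^ 2 / b] for [u = 2 ^ i], an integer because [j <= i <= J]. The incidence bound
     is stated with [q.+1], hence the predecessor below. *)
  pose q := (8 ^ (J.+1 - j) * 4 ^ i)%N.
  have q0 : (0 < q)%N by rewrite muln_gt0 !expn_gt0.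
  have := sum_perp_at posI (8 ^ i) (8 ^ j) q.-1; rewrite prednK // -/n => le.
  rewrite /P !natrM !natrX.
  apply: (@layer_bound _ _ _ (2 ^+ i) (8 ^+ J.+1) n%:R q%:R _
    #|inc_lines pos (8 ^ i)|%:R #|inc_lines pos (8 ^ j)|%:R).
  - by rewrite exprn_gt0.
  - by rewrite -exprM mulnC exprM; congr (_ ^+ _); ring.
  - by rewrite exprn_gt0.
  - by rewrite exprn_gt0.
  - rewrite /q natrM !natrX mulrAC -exprD subnK; last by lia.
    by rewrite -exprM mulnC exprM; congr (_ * _ ^+ _); ring.
  - by [].
  - by rewrite -!natrX ler_nat.
  - by rewrite mulr_ge0 ?exprn_ge0.
  - move: le; rewrite -(ler_nat R) !natrD !natrM !natrX; congr (_ <= _); ring.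
  - by have := rich i (leqW iJ); rewrite -(ler_nat R) !natrM !natrX.
  - have jJ : (j <= J.+1)%N by lia.
    by have := rich j jJ; rewrite -(ler_nat R) !natrM !natrX.
have total : (#|rights pos| <= 2 * (n * #|inc_lines pos m|) +
    64 * \sum_(i < J.+1) \sum_(j < J.+1) P i j)%N.
  apply: leq_trans (card_rights posI J.+1) _; rewrite leq_add2l.
  exact: rights_low.
move: total high; rewrite -!(ler_nat R) natrD ![(2 * _)%:R]natrM ![(64 * _)%:R]natrM.
rewrite [(1152 * _ * m)%:R]natrM [(1152 * _)%:R]natrM natrX.
(* [2178 = 2 + 64 * 2 * 17], from the rich lines and from the layers. *)
have -> : 1152 * 2178 * n%:R ^+ 2 * m%:R = 2 * (1152 * n%:R ^+ 2 * m%:R) +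
  64 * (2 * (1152 * n%:R ^+ 2 * (17 * m%:R))) :> R by ring.
by move=> le leh; apply: le_trans le _; rewrite lerD ?ler_pM2l.
Qed.

End RightAngles.

(** * Chains of right angles *)

Section ChainGeometry.
Variable R : realType.
Implicit Types (u v x y z d e p : 'rV[R]_3).

Lemma dotv_cauchy_schwarz u v : dotv u v ^+ 2 <= dotv u u * dotv v v.
Proof.
(* Lagrange's identity. *)
rewrite -subr_ge0; have -> : dotv u u * dotv v v - dotv u v ^+ 2 =
  cx (cross u v) ^+ 2 + cy (cross u v) ^+ 2 + cz (cross u v) ^+ 2 by sring.
by rewrite !addr_ge0 // sqr_ge0.
Qed.

(** By Cauchy-Schwarz the quotient is in [[-1, 1]], where [cos] inverts [acos]. *)
Lemma right_angleP x y z : right_angle x y z ->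
  [/\ x != y, z != y & dotv (x - y) (z - y) = 0].
Proof.
move=> /and3P[xy yz /eqP]; rewrite eq_sym in yz; rewrite /angle /enorm => ang.
have norm_gt0 u : u != 0 -> 0 < Num.sqrt (dotv u u).
  rewrite sqrtr_gt0 lt_def dotvv_eq0 => ->; rewrite dotvE -!expr2.
  by rewrite !addr_ge0 // sqr_ge0.
move: ang; rewrite -subr_eq0 in xy; rewrite -subr_eq0 in yz; split=> //.
- by rewrite -subr_eq0.
- by rewrite -subr_eq0.
move: (x - y) (z - y) xy yz ang => u v /norm_gt0 u0 /norm_gt0 v0 ang.
set q := _ / _ in ang; have uv0 := mulr_gt0 u0 v0.
have q1 : `|q| <= 1.
  rewrite normrM normfV (gtr0_norm uv0) ler_pdivrMr // mul1r -sqrtrM.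
    by rewrite -sqrtr_sqr ler_wsqrtr // dotv_cauchy_schwarz.
  by move: u0; rewrite sqrtr_gt0 => /ltW.
have : cos (acos q) = q by apply: acosK; rewrite in_itv /= -ler_norml.
rewrite ang cos_pihalf => /esym/eqP.
by rewrite mulf_eq0 invr_eq0 (gt_eqF uv0) orbF => /eqP.
Qed.

(** Points of the line through [x2] along [e] are [x2 + t *: e]; the right angle gives an equation
    with factor [t], and excluding [t = 0] leaves only the foot of the perpendicular from [x0]. *)
Lemma foot_on_parallel x0 x1 x1' x2 e :
  e != 0 -> x1 != x2 -> x1' != x2 ->
  cross e (x1 - x2) = 0 -> cross e (x1' - x2) = 0 ->
  dotv (x0 - x1) (x2 - x1) = 0 -> dotv (x0 - x1') (x2 - x1') = 0 -> x1 = x1'.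
Proof.
move=> e0; have ee : dotv e e != 0 by rewrite dotvv_eq0.
have param x : x != x2 -> cross e (x - x2) = 0 -> dotv (x0 - x) (x2 - x) = 0 ->
    x = x2 + (dotv (x0 - x2) e / dotv e e) *: e.
  move=> xx2 /(cross_eq0 e0)[t et]; have -> : x = x2 + t *: e by rewrite -et addrC subrK.
  have t0 : t != 0.
    by apply: contra xx2 => /eqP t0; move/eqP: et; rewrite t0 scale0r subr_eq0.
  have -> : dotv (x0 - (x2 + t *: e)) (x2 - (x2 + t *: e)) =
    t * (t * dotv e e - dotv (x0 - x2) e) by sring.
  move/eqP; rewrite mulf_eq0 (negPf t0) /= subr_eq0 => /eqP <-.
  by rewrite mulfK.
by move=> n1 n2 c1 c2 d1 d2; rewrite (param _ n1 c1 d1) (param _ n2 c2 d2).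
Qed.

(** The two planes meet in a line with direction [c = cross d e]. Along it from the known solution
    [p], the sphere with diameter [x2 x4] gives a quadratic with root 0, so there is at most one
    further root. *)
Lemma line_sphere_two x2 x4 d e p p1 p2 : cross d e != 0 ->
  let sol q := [/\ dotv d (q - x2) = 0, dotv (q - x4) e = 0 & dotv (x2 - q) (x4 - q) = 0] in
  sol p -> sol p1 -> sol p2 -> p1 != p -> p2 != p -> p1 = p2.
Proof.
move=> c0 sol [pd pe pp] s1 s2 n1 n2; set c := cross d e in c0.
have cc : dotv c c != 0 by rewrite dotvv_eq0.
have param q : sol q -> q != p -> q = p + (dotv c ((x2 - p) + (x4 - p)) / dotv c c) *: c.
  move=> [qd qe qq] qp; have : cross c (q - p) = 0.
    have -> : cross c (q - p) = (dotv d (q - x2) - dotv d (p - x2)) *: e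
        - (dotv (q - x4) e - dotv (p - x4) e) *: d by rewrite /c; vring.
    by rewrite pd pe qd qe !subrr !scale0r subrr.
  move/(cross_eq0 c0) => [t et]; have qE : q = p + t *: c by rewrite -et addrC subrK.
  have t0 : t != 0.
    by apply: contra qp => /eqP t0; move/eqP: et; rewrite t0 scale0r subr_eq0.
  move: qq; rewrite qE; move: (c) cc => g gg.
  have -> : dotv (x2 - (p + t *: g)) (x4 - (p + t *: g)) = dotv (x2 - p) (x4 - p) +
    t * (t * dotv g g - dotv g (x2 - p + (x4 - p))) by sring.
  rewrite pp add0r => /eqP; rewrite mulf_eq0 (negPf t0) /= subr_eq0 => /eqP <-.
  by rewrite mulfK.
by rewrite (param _ s1 n1) (param _ s2 n2).
Qed.

End ChainGeometry.

(** The entries from index [d] on; used with [m + d = N.+1], where [inord] does not truncate. *)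
Definition shift (T : Type) (N d m : nat) (t : N.+1.-tuple T) : m.-tuple T :=
  [tuple tnth t (inord (j + d)) | j < m].

Lemma tnth_shift (T : Type) N d m (t : N.+1.-tuple T) j : (j < m.+1)%N ->
  tnth (shift d m.+1 t) (inord j) = tnth t (inord (j + d)).
Proof. by move=> jm; rewrite tnth_mktuple inordK. Qed.

(** * Splitting the chains *)

Section Chains.
Variables (R : realType) (E : {fset 'rV[R]_3}).

Let pos : E -> 'rV[R]_3 := val.

Lemma LambdaP m (t : m.+2.-tuple E) : t \in Lambda E m -> forall j, (j < m)%N ->
  right_angle (pos (tnth t (inord j))) (pos (tnth t (inord j.+1))) (pos (tnth t (inord j.+2))).
Proof. by rewrite in_set => /forallP tL j jm; have := tL (Ordinal jm). Qed.

Lemma shift_Lambda d m (t : (d + m).+2.-tuple E) :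
  t \in Lambda E (d + m) -> shift d m.+2 t \in Lambda E m.
Proof.
move=> tL; rewrite in_set; apply/forallP => j; have jm := ltn_ord j.
rewrite !tnth_shift; try lia.
by have := LambdaP tL (j := j + d); rewrite !addSn; apply; lia.
Qed.

Lemma tuple_ext N (t t' : N.+1.-tuple E) :
  (forall j, (j <= N)%N -> tnth t (inord j) = tnth t' (inord j)) -> t = t'.
Proof.
move=> e; apply: eq_from_tnth => i; have := e i; rewrite inord_val; apply.
by rewrite -ltnS.
Qed.

Section Split.
Variable k : nat.

Let X (t : k.+4.+2.-tuple E) j := tnth t (inord j).

Lemma shiftE d m (t t' : k.+4.+2.-tuple E) j : (d + m = k.+4.+1)%N ->
  shift d m.+1 t = shift d m.+1 t' -> (d <= j)%N -> (j <= k.+4.+1)%N -> X t j = X t' j.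
Proof.
move=> dm es dj jk; have := congr1 (fun s => tnth s (inord (j - d))) es.
by rewrite !tnth_shift ?subnK //; lia.
Qed.

(** Indices start at 0: the two planes containing [X t 3] have normals [X t 1 - X t 2] and
    [X t 5 - X t 4], which are parallel here. *)
Let degenerate := [set t in Lambda E k.+4 |
  cross (pos (X t 1) - pos (X t 2)) (pos (X t 5) - pos (X t 4)) == 0].

(** Only [X t 1] must be recovered from [X t 0] and the entries from index 2 on: it is the foot of
    the perpendicular from [X t 0] to the line through [X t 2] parallel to [X t 5 - X t 4]. *)
Lemma card_degenerate : (#|degenerate| <= #|` E| * #|Lambda E k.+2|)%N.
Proof.
rewrite cardfE -cardsT -cardsX.
apply: (@card_le_rel _ _ _ _ (fun t p => p = (X t 0, shift 2 k.+4 t)))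
  => [t|t t' p]; rewrite in_set => /andP[tL c0].
  by exists (X t 0, shift 2 k.+4 t); rewrite // in_setX in_setT /= (@shift_Lambda 2 k.+2).
rewrite in_set => /andP[t'L c0'] -> e.
have /= e0 := congr1 fst e; have /= es := congr1 snd e.
have eX j : (2 <= j)%N -> (j <= k.+4.+1)%N -> X t j = X t' j.
  exact: (@shiftE 2 k.+3 t t' j (erefl _) es).
apply: tuple_ext => -[|[|j]] jk //; last by apply: eX.
have [n01 n21 d1] := right_angleP (LambdaP tL (isT : (0 < k.+4)%N)).
have [n01' n21' d1'] := right_angleP (LambdaP t'L (isT : (0 < k.+4)%N)).
have [_ n54 _] := right_angleP (LambdaP tL (isT : (3 < k.+4)%N)).
move: e0 d1 d1' n21 n21' c0 c0' n54; rewrite -!/(X _ _) => <-.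
rewrite -(eX 2) // -(eX 4) // -(eX 5) // => d1 d1' n21 n21' /eqP c0 /eqP c0' n54.
apply: val_inj.
have swap (u v : 'rV[R]_3) : cross u v = 0 -> cross v u = 0.
  by rewrite [cross v u]crossC => ->; rewrite oppr0.
apply: (@foot_on_parallel _ (pos (X t 0)) _ _ (pos (X t 2)) (pos (X t 5) - pos (X t 4))).
- by rewrite subr_eq0.
- by rewrite eq_sym.
- by rewrite eq_sym.
- exact: swap.
- exact: swap.
- by [].
- by [].
Qed.

Let generic := Lambda E k.+4 :\: degenerate.

Let in_generic t : (t \in generic) = (t \notin degenerate) && (t \in Lambda E k.+4).
Proof. exact: in_setD. Qed.

(** Every entry except [X t 3]: the right triple at the start and the tail from index 4. *)
Let key t := ((X t 0, X t 1, X t 2), shift 4 k.+2 t).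

Lemma generic_solution t : t \in Lambda E k.+4 ->
  [/\ dotv (pos (X t 1) - pos (X t 2)) (pos (X t 3) - pos (X t 2)) = 0,
      dotv (pos (X t 3) - pos (X t 4)) (pos (X t 5) - pos (X t 4)) = 0 &
      dotv (pos (X t 2) - pos (X t 3)) (pos (X t 4) - pos (X t 3)) = 0].
Proof.
move=> tL.
have [_ _ d1] := right_angleP (LambdaP tL (isT : (1 < k.+4)%N)).
have [_ _ d2] := right_angleP (LambdaP tL (isT : (2 < k.+4)%N)).
by have [_ _ d3] := right_angleP (LambdaP tL (isT : (3 < k.+4)%N)).
Qed.

Let keyE t t' : key t = key t' -> forall j, (j != 3)%N -> (j <= k.+4.+1)%N -> X t j = X t' j.
Proof.
move=> e; have [/= e0 e1 e2] := congr1 fst e; have /= es := congr1 snd e.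
case=> [|[|[|[|j]]]] // _ jk.
exact: (@shiftE 4 k.+1 t t' _ (erefl _) es).
Qed.

Let key_inj t t' : key t = key t' -> X t 3 = X t' 3 -> t = t'.
Proof.
move=> ek e3; apply: tuple_ext => j jk.
by have [->|j3] := eqVneq j 3%N; [exact: e3|exact: keyE].
Qed.

Let third_point t0 t t' : t0 \in generic -> t \in generic -> t' \in generic ->
  key t = key t0 -> key t' = key t0 -> X t 3 != X t0 3 -> X t' 3 != X t0 3 -> X t 3 = X t' 3.
Proof.
rewrite !in_generic => /andP[nd0 t0L] /andP[_ tL] /andP[_ t'L] ek ek' n n'.
have c0 : cross (pos (X t0 1) - pos (X t0 2)) (pos (X t0 5) - pos (X t0 4)) != 0.
  by move: nd0; rewrite in_set t0L.
have eX u : key u = key t0 ->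
    [/\ X u 1 = X t0 1, X u 2 = X t0 2, X u 4 = X t0 4 & X u 5 = X t0 5].
  by move=> eu; split; apply: keyE.
have [e1 e2 e4 e5] := eX t ek; have [e1' e2' e4' e5'] := eX t' ek'.
have s := generic_solution tL; rewrite e1 e2 e4 e5 in s.
have s' := generic_solution t'L; rewrite e1' e2' e4' e5' in s'.
exact: val_inj (line_sphere_two c0 (generic_solution t0L) s s' n n').
Qed.

(** At most two generic chains share a key, so one boolean separates them. *)
Lemma card_generic : (#|generic| <= 2 * #|rights pos| * #|Lambda E k|)%N.
Proof.
(* The reference chain [t0] is picked from the key alone, so chains with equal keys are compared
   with the same one; the default is never reached on generic chains. *)
pose first t := if [pick t0 in generic | key t0 == key t] is Some t0
  then X t 3 == X t0 3 else false.
have firstP t t' : t \in generic -> key t = key t' -> exists t0,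
    [/\ t0 \in generic, key t = key t0, first t = (X t 3 == X t0 3) &
        first t' = (X t' 3 == X t0 3)].
  move=> tG ek; rewrite /first -ek; case: pickP => [t0 /andP[t0G /eqP ek0]|/(_ t)].
    by exists t0.
  by rewrite tG eqxx.
have -> : (2 * #|rights pos| * #|Lambda E k| =
    #|setX (setX (rights pos) (Lambda E k)) [set: bool]|)%N.
  by rewrite !cardsX cardsT card_bool; lia.
apply: (@card_le_rel _ _ _ _ (fun t p => p = (key t, first t))) => [t|t t' p tG t'G].
  rewrite in_generic => /andP[_ tL]; exists (key t, first t) => //.
  rewrite !in_setX in_setT andbT /= (@shift_Lambda 4 k) // andbT in_rights.
  have [-> -> ->] := right_angleP (LambdaP tL (isT : (0 < k.+4)%N)).
  by rewrite eqxx.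
move=> -> e; have /= ek := congr1 fst e; have /= ef := congr1 snd e.
apply: key_inj => //; have [t0 [t0G ek0 f f']] := firstP t t' tG ek.
move: ef; rewrite f f'; have [->|n] := eqVneq (X t 3) (X t0 3).
  by move=> /esym/eqP.
have [//|n'] := eqVneq (X t' 3) (X t0 3) => _.
by apply: (third_point t0G tG t'G ek0) => //; rewrite -ek.
Qed.

Lemma card_Lambda_split : (#|Lambda E k.+4| <=
  #|` E| * #|Lambda E k.+2| + 2 * #|rights pos| * #|Lambda E k|)%N.
Proof.
rewrite -(cardsID degenerate (Lambda E k.+4)) leq_add ?card_generic //.
by apply: leq_trans card_degenerate; rewrite subset_leq_card ?subsetIr.
Qed.

End Split.
End Chains.

(** * The inequality with real exponents *)

Theorem theorem4p8 (R : realType) (k : nat) (hk : (5 <= k)%N) :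
  exists (C : R) (N : nat), 0 < C /\
    forall (n : nat) (E : {fset 'rV[R]_3}), (N < n)%N -> #|` E| = n ->
      #|Lambda E k|%:R <=
        C * (n%:R * #|Lambda E (k - 2)|%:R
             + n%:R `^ (7%:R / 3%:R) * #|Lambda E (k - 4)|%:R).
Proof.
case: k hk => [|[|[|[|k]]]] // _; have -> : (k.+4 - 2 = k.+2)%N by rewrite -addn2 addnK.
have -> : (k.+4 - 4 = k)%N by rewrite -addn4 addnK.
(* [16 = 2 * 8]: the 2 comes from the split, the 8 from [m <= 8 * n ^ (1/3)]. [N = 1] provides the
   [1 < n] that the count of right triples requires. *)
exists (16 * (1152 * 2178)), 1%N; split; first by rewrite !mulr_gt0.
move=> n E n1 En.
have [m [m_le rights_le]] : exists m : nat, (m ^ 3 <= 512 * n)%N /\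
    (#|rights (val : E -> 'rV[R]_3)|%:R <= 1152 * 2178 * n%:R ^+ 2 * m%:R :> R).
  by have := card_rights_le (@val_inj _ _ E); rewrite -cardfE En; apply.
have n0 : 0 <= n%:R :> R by [].
have m8 : m%:R <= 8 * n%:R `^ (1 / 3) :> R.
  have m80 : 0 <= m%:R / 8 :> R by rewrite divr_ge0.
  rewrite mulrC -ler_pdivrMr //.
  (* The cube root is taken on [(m / 8) ^+ 3 <= n], which is [m ^ 3 <= 512 * n]. *)
  have -> : m%:R / 8 = ((m%:R / 8) ^+ 3) `^ (1 / 3) :> R.
    by rewrite -powR_mulrn // -powRrM mul1r divff ?powRr1 // pnatr_eq0.
  apply: ge0_ler_powR; rewrite ?nnegrE ?exprn_ge0 ?divr_ge0 //.
  rewrite expr_div_n ler_pdivrMr ?exprn_gt0 //.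
  by move: m_le; rewrite -(ler_nat R) natrX natrM; congr (_ <= _); ring.
have pow : n%:R `^ (7%:R / 3%:R) = n%:R ^+ 2 * n%:R `^ (1 / 3) :> R.
  have -> : 7%:R / 3%:R = 2%:R + 1 / 3 :> R by field.
  rewrite powRD ?powR_mulrn //; apply/implyP => _.
  by rewrite pnatr_eq0 -lt0n (ltnW n1).
have := card_Lambda_split E k; rewrite En -(ler_nat R) natrD !natrM => /le_trans; apply.
rewrite mulrDr; apply: lerD.
  by rewrite ler_peMl ?mulr_ge0 //; lra.
rewrite mulrA ler_wpM2r // pow; apply: (@le_trans _ _ (2 * (1152 * 2178 * n%:R ^+ 2 * m%:R))).
  by rewrite ler_pM2l.
have n2 : 0 <= 2 * (1152 * 2178 * n%:R ^+ 2) :> R by rewrite !mulr_ge0 ?exprn_ge0.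
apply: le_trans (_ : 2 * (1152 * 2178 * n%:R ^+ 2) * (8 * n%:R `^ (1 / 3)) <= _).
  by rewrite -[X in X <= _]/(2 * (1152 * 2178 * n%:R ^+ 2 * m%:R)) mulrA ler_wpM2l.
by rewrite le_eqVlt; apply/orP; left; apply/eqP; ring.
Qed.
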